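(* Let $p\geq 5$ be a prime and $r$ a positive integer. Then \[ 4\sum_{\substack{i_{1}+i_{2}+i_{3}+i_{4}=2p^{r}\\ i_{1},i_{2},i_{3},i_{4}\in \mathcal{P}_{p}}}\frac{(-1)^{i_{1}}}{i_{1}i_{2}i_{3}i_{4}}+3\sum_{\substack{i_{1}+i_{2}+i_{3}+i_{4}=2p^{r}\\ i_{1},i_{2},i_{3},i_{4}\in \mathcal{P}_{p}}}\frac{(-1)^{i_{1}+i_{2}}}{i_{1}i_{2}i_{3}i_{4}} \equiv\begin{cases} \frac{216}{5}pB_{p-5}\pmod{p^{2}}, & \text{if } r=1,\\[2pt] \frac{36}{5}p^{r}B_{p-5}\pmod{p^{r+1}}, & \text{if } r>1. \end{cases} \]
   Context: $\mathcal{P}_{n}$ denotes the set of positive integers coprime to $n$; the sums run over ordered quadruples of positive integers, each coprime to $p$, with the indicated sum. The Bernoulli numbers $B_k$ are defined by $B_0=1$ and $\sum_{i=0}^{n}\binom{n+1}{i}B_{i}=0$ for $n\geq 1$. Congruences between rational numbers whose denominators are coprime to $p$ are understood in the ring of $p$-integral rationals: $a\equiv b \pmod{p^s}$ means $(a-b)/p^s$ has denominator coprime to $p$. *)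

(* Defs.v *)
From HB Require Import structures.
From mathcomp Require Import all_boot all_order all_algebra.

Set Implicit Arguments.
Unset Strict Implicit.
Unset Printing Implicit Defensive.

Import Order.TTheory GRing.Theory Num.Theory.
Local Open Scope ring_scope.

(* [:: B_0; ...; B_n]: the recurrence \sum_(i <= m) 'C(m+1, i) B_i = 0, solved
   for B_m (whose coefficient is 'C(m+1, m) = m+1). *)
Fixpoint bernoulli_seq (n : nat) : seq rat :=
  if n is m.+1 then
    let s := bernoulli_seq m in
    rcons s (- (\sum_(i < n) 'C(n.+1, i)%:R * s`_i) / n.+1%:R)
  else [:: 1].

Definition bernoulli (n : nat) : rat := (bernoulli_seq n)`_n.

Lemma size_bernoulli_seq n : size (bernoulli_seq n) = n.+1.
Proof. by elim: n => //= n IHn; rewrite size_rcons IHn. Qed.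

Lemma nth_bernoulli_seq n i : (i <= n)%N -> (bernoulli_seq n)`_i = bernoulli i.
Proof.
elim: n => [|n IHn]; first by case: i.
rewrite leq_eqVlt => /predU1P[-> //|lt_in].
by rewrite [bernoulli_seq _]/= nth_rcons size_bernoulli_seq lt_in IHn.
Qed.

Lemma bernoulli0 : bernoulli 0 = 1.
Proof. by []. Qed.

Lemma bernoulli_rec n :
  (0 < n)%N -> \sum_(i < n.+1) 'C(n.+1, i)%:R * bernoulli i = 0.
Proof.
case: n => // n _; rewrite big_ord_recr /= [bernoulli n.+1]/bernoulli /=.
rewrite nth_rcons size_bernoulli_seq ltnn eqxx binSn mulrC divfK ?pnatr_eq0 //.
apply/eqP; rewrite subr_eq0; apply/eqP; apply: eq_bigr => i _.
by rewrite nth_bernoulli_seq // -ltnS.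
Qed.

(* The bound i_k <= N on the indices follows from i1 + i2 + i3 + i4 = N. *)
Definition sum4 (p N : nat) (F : nat -> nat -> nat -> nat -> rat) : rat :=
  \sum_(i1 < N.+1 | (0 < i1)%N && coprime i1 p)
  \sum_(i2 < N.+1 | (0 < i2)%N && coprime i2 p)
  \sum_(i3 < N.+1 | (0 < i3)%N && coprime i3 p)
  \sum_(i4 < N.+1 | [&& (0 < i4)%N, coprime i4 p
                      & (i1 + i2 + i3 + i4 == N)%N]) F i1 i2 i3 i4.

Definition eqmod_rat (p s : nat) (a b : rat) : Prop :=
  coprime `|denq ((a - b) / p%:R ^+ s)|%N p.

(* Main.v *)
From HB Require Import structures.
Require Import Defs.
From mathcomp Require Import all_boot all_order all_algebra.
From mathcomp Require Import ring lra zify.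
Set Implicit Arguments.
Unset Strict Implicit.
Unset Printing Implicit Defensive.
Import Order.TTheory GRing.Theory Num.Theory.
Local Open Scope ring_scope.

(* Let T(N) be the sum of 1/(i1 i2 i3 i4) over i1 + i2 + i3 + i4 = N with all
   i_k prime to p, i.e. the coefficient of x^N in f^4, f = sum_{p !| i} x^i / i.
   Since f(x) + f(-x) = f(x^2), expanding (f(x) + f(-x))^4 turns the sum of the
   theorem into T(p^r) / 2 - T(2 p^r).

   For Q = p^r, write an index i = a Q + y with 0 < y < Q and expand 1/(a Q + y)
   in powers of Q: T(n Q) becomes a combination of the values at Q, 2Q, 3Q of
   fixed coefficient sums, with binomial coefficients in n.  The symmetry
   y -> Q - y and the case n = 2 eliminate all of them but T(Q) and T(2Q), and
   for n = p, 2p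
     T(n Q) = n (4 - n^2) / 3 T(Q) + n (n^2 - 1) / 6 T(2Q)   (mod p^(r+2)),
   which gives the theorem by induction on r.

   For r = 1, the differential equation of the logarithmic series expresses
   T(p) and T(2p) by the power sums of the 1/j; modulo p^2 only H_4 = sum 1/j^4
   matters.  Splitting 0 < j < p into {i, p - i} and into {2i, p - 2i} relates
   both H_4 and sum j^(p-5) to sum_{i < p/2} i^(-5), so 5 H_4 = 4 p B_(p-5)
   modulo p^2 by Faulhaber's formula.  This needs p > 5; p = 5 is computed. *)

(** * p-integral rationals *)

(* [pint] and [pdvd] are locked to keep [done] from evaluating memberships. *)
Fact pint_key : unit. Proof. exact: tt. Qed.

Definition pint (p : nat) : {pred rat} :=
  locked_with pint_key (fun x => coprime `|denq x| p).

Lemma pintE p x : (x \in pint p) = coprime `|denq x| p.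
Proof. by rewrite /pint unlock. Qed.

(** Any denominator prime to [p] serves, not only the reduced one, so closure under sums and
    products needs no reduction. The reduced denominator divides every other one because it is
    coprime to the numerator. *)
Lemma pintP (p : nat) (x : rat) :
  reflect (exists2 d : nat, (0 < d)%N && coprime d p
             & exists a : int, x * d%:R = a%:~R)
          (x \in pint p).
Proof.
rewrite pintE; apply: (iffP idP) => [px|[d /andP[d0 cd] [a Ea]]].
  exists `|denq x|%N; first by rewrite absz_gt0 denq_neq0; exact: px.
  exists (numq x).
  have -> : `|denq x|%:R = (denq x)%:~R :> rat.
    by rewrite -[in RHS](gez0_abs (ltW (denq_gt0 x))).
  by rewrite -{1}[x]divq_num_den mulfVK // intr_eq0 denq_neq0.
have E : numq x * (d : int) = a * denq x.
  apply: (@intr_inj rat); rewrite !intrM -Ea -{2}[x]divq_num_den.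
  by rewrite mulrAC mulfVK ?intr_eq0 ?denq_neq0.
have : (`|denq x| %| `|numq x| * d)%N.
  have -> : (`|numq x| * d = `|a| * `|denq x|)%N.
    by rewrite -[d]/(`|Posz d|)%N -!abszM E.
  exact: dvdn_mull.
rewrite Gauss_dvdr; first by move=> h; exact: coprime_dvdl h cd.
by rewrite coprime_sym coprime_num_den.
Qed.

Lemma pint_subring p : subring_closed (pint p).
Proof.
split=> [|x y /pintP[d /andP[d0 cd] [a Ea]] /pintP[e /andP[e0 ce] [b Eb]]|
          x y /pintP[d /andP[d0 cd] [a Ea]] /pintP[e /andP[e0 ce] [b Eb]]].
- by apply/pintP; exists 1%N; [rewrite coprime1n | exists 1; rewrite mulr1].
- apply/pintP; exists (d * e)%N; first by rewrite muln_gt0 d0 e0 coprimeMl cd.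
  exists (a * e - b * d).
  by rewrite natrM rmorphB !rmorphM /= -Ea -Eb -!pmulrn; ring.
- apply/pintP; exists (d * e)%N; first by rewrite muln_gt0 d0 e0 coprimeMl cd.
  by exists (a * b); rewrite natrM rmorphM /= -Ea -Eb; ring.
Qed.

HB.instance Definition _ p :=
  GRing.isSubringClosed.Build rat (pint p) (pint_subring p).

Lemma pint_natV p d : coprime d p -> d%:R^-1 \in pint p.
Proof.
case: d => [|d] cd; first by rewrite invr0 rpred0.
apply/pintP; exists d.+1; rewrite ?cd //.
by exists 1; rewrite mulVf ?pnatr_eq0.
Qed.

(* [pdvd p s x] says that [x] lies in the ideal [p^s Z_(p)]. *)
Definition pdvd (p s : nat) : {pred rat} :=
  locked_with pint_key (fun x => x / p%:R ^+ s \in pint p).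

Lemma pdvdE p s x : (x \in pdvd p s) = (x / p%:R ^+ s \in pint p).
Proof. by rewrite /pdvd unlock. Qed.

Lemma pdvd_zmod p s : zmod_closed (pdvd p s).
Proof.
split=> [|x y]; rewrite !pdvdE; first by rewrite mul0r rpred0.
by rewrite mulrBl; apply: rpredB.
Qed.

HB.instance Definition _ p s :=
  GRing.isZmodClosed.Build rat (pdvd p s) (pdvd_zmod p s).

Section Ideal.
Variable p : nat.
Hypothesis p_gt0 : (0 < p)%N.

Lemma natp_neq0 : p%:R != 0 :> rat.
Proof. by rewrite pnatr_eq0 -lt0n. Qed.

Lemma pdvdP s x :
  reflect (exists2 y, y \in pint p & x = p%:R ^+ s * y) (x \in pdvd p s).
Proof.
have ps0 : p%:R ^+ s != 0 :> rat by rewrite expf_neq0 // natp_neq0.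
rewrite pdvdE; apply: (iffP idP) => [h|[y hy ->]].
  by exists (x / p%:R ^+ s) => //; rewrite mulrCA divff ?mulr1.
by rewrite mulrAC divff ?mul1r.
Qed.

Lemma pdvd0 : pdvd p 0 =i pint p.
Proof. by move=> x; rewrite pdvdE expr0 divr1. Qed.

Lemma pdvdM s t x y :
  x \in pdvd p s -> y \in pdvd p t -> x * y \in pdvd p (s + t).
Proof.
move=> /pdvdP[a ha ->] /pdvdP[b hb ->]; apply/pdvdP.
by exists (a * b); [apply: rpredM | rewrite exprD; ring].
Qed.

Lemma pdvdMl s x y : x \in pint p -> y \in pdvd p s -> x * y \in pdvd p s.
Proof. by rewrite -pdvd0; apply: pdvdM. Qed.

Lemma pdvdMr s x y : x \in pdvd p s -> y \in pint p -> x * y \in pdvd p s.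
Proof. by move=> hx hy; rewrite mulrC pdvdMl. Qed.

Lemma pdvdXp s y : y \in pint p -> p%:R ^+ s * y \in pdvd p s.
Proof. by move=> hy; apply/pdvdP; exists y. Qed.

Lemma pdvd_leq s t x : (s <= t)%N -> x \in pdvd p t -> x \in pdvd p s.
Proof.
move=> st /pdvdP[y hy ->]; apply/pdvdP; exists (p%:R ^+ (t - s) * y).
  by rewrite rpredM // rpredX // rpred_nat.
by rewrite mulrA -exprD subnKC.
Qed.

Lemma pdvd_unit s d x :
  coprime d p -> (0 < d)%N -> d%:R * x \in pdvd p s -> x \in pdvd p s.
Proof.
move=> cd d0 h; have -> : x = d%:R^-1 * (d%:R * x).
  by rewrite mulrA mulVf ?mul1r // pnatr_eq0 -lt0n.
by rewrite pdvdMl // pint_natV.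
Qed.

End Ideal.

Lemma eqmod_ratP p s a b : a - b \in pdvd p s -> eqmod_rat p s a b.
Proof. by rewrite pdvdE pintE. Qed.

(** * Reduction to T4 *)

(** Extending [1/i] by 0 to the multiples of [p] moves the restriction on the indices into
    coefficients, so that the sums become coefficients of products of polynomials. *)
Definition cinv (p i : nat) : rat := if coprime i p then i%:R^-1 else 0.

(** The case [k = 1] is a truncation of [f]; the cases [k = 2, 3] enter through the expansion of
    [1/(a Q + y)] in powers of [Q]. *)
Definition invpoly (p n k : nat) : {poly rat} := \poly_(i < n) cinv p i ^+ k.

(* The sum of 1 / (i1 i2 i3 i4) over i1 + i2 + i3 + i4 = N. *)
Definition T4 (p N : nat) : rat := (invpoly p N.+1 1 ^+ 4)`_N.

Lemma coefM4_poly (n N : nat) (a b c d : nat -> rat) :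
  (\poly_(i < n) a i * \poly_(i < n) b i * \poly_(i < n) c i
     * \poly_(i < n) d i)`_N =
  \sum_(i1 < n) \sum_(i2 < n) \sum_(i3 < n)
    \sum_(i4 < n | (i1 + i2 + i3 + i4 == N)%N) a i1 * b i2 * c i3 * d i4.
Proof.
rewrite !poly_def -!mulrA mulr_suml coef_sum; apply: eq_bigr => i1 _.
rewrite mulr_suml mulr_sumr coef_sum; apply: eq_bigr => i2 _.
rewrite mulr_suml !mulr_sumr coef_sum; apply: eq_bigr => i3 _.
rewrite !mulr_sumr coef_sum [RHS]big_mkcond; apply: eq_bigr => i4 _.
set m := _ * _; have -> : m = (a i1 * b i2 * c i3 * d i4) *: 'X^(i1 + i2 + i3 + i4).
  by rewrite /m !exprD -!mul_polyC !rmorphM /=; ring.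
by rewrite coefZ coefXn eq_sym; case: eqP => _; rewrite ?mulr1 ?mulr0.
Qed.

(** The weights [a], [b], [c], [d] are there to carry the signs of the two sums. *)
Lemma sum4_coef (p N : nat) (a b c d : nat -> rat) : (1 < p)%N ->
  sum4 p N (fun i1 i2 i3 i4 =>
     (a i1 * b i2 * c i3 * d i4) / (i1%:R * i2%:R * i3%:R * i4%:R)) =
  (\poly_(i < N.+1) (a i * cinv p i) * \poly_(i < N.+1) (b i * cinv p i)
    * \poly_(i < N.+1) (c i * cinv p i) * \poly_(i < N.+1) (d i * cinv p i))`_N.
Proof.
move=> p1; rewrite coefM4_poly /sum4.
have cop i : ((0 < i) && coprime i p)%N = coprime i p.
  by case: i => //=; rewrite /coprime gcd0n; case: eqP p1 => // ->.
rewrite big_mkcond; apply: eq_bigr => i1 _ /=; rewrite cop.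
case: (boolP (coprime i1 p)) => ci1; last first.
  by symmetry; do 3!(apply: big1 => ? _); rewrite /cinv (negPf ci1) !(mulr0,mul0r).
rewrite big_mkcond; apply: eq_bigr => i2 _ /=; rewrite cop.
case: (boolP (coprime i2 p)) => ci2; last first.
  by symmetry; do 2!(apply: big1 => ? _); rewrite /cinv (negPf ci2) !(mulr0,mul0r).
rewrite big_mkcond; apply: eq_bigr => i3 _ /=; rewrite cop.
case: (boolP (coprime i3 p)) => ci3; last first.
  by symmetry; apply: big1 => ? _; rewrite /cinv (negPf ci3) !(mulr0,mul0r).
rewrite [LHS]big_mkcond [RHS]big_mkcond; apply: eq_bigr => i4 _ /=.
rewrite andbA cop; case: eqP => _; rewrite ?(andbF,andbT) //.
case: (boolP (coprime i4 p)) => ci4; rewrite /cinv ci1 ci2 ci3 ?(negPf ci4) ?ci4.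
  by rewrite !invfM; ring.
by rewrite !mulr0.
Qed.

Lemma coef_comp_opp (u : {poly rat}) i : (u \Po - 'X)`_i = (-1) ^+ i * u`_i.
Proof.
elim/poly_ind: u i => [|u c IH] i; first by rewrite comp_poly0 coef0 mulr0.
rewrite comp_polyD comp_polyM comp_polyX comp_polyC mulrN !coefD coefN.
rewrite !coefMX !coefC; case: i => [|i] /=; first by rewrite oppr0 mul1r.
by rewrite IH !addr0 exprS; ring.
Qed.

Lemma cinv_double p j : (2 < p)%N -> prime p ->
  2%:R * cinv p (2 * j) = cinv p j.
Proof.
move=> p2 pr; rewrite /cinv coprimeMl.
have -> : coprime 2 p by rewrite coprime_sym prime_coprime // gtnNdvd.
rewrite /=; case: ifP => _; last by rewrite mulr0.
case: j => [|j]; first by rewrite muln0 invr0 mulr0.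
by rewrite natrM invfM mulrA divff ?mul1r.
Qed.

(** The odd terms cancel. An even index [2j] gives [2/(2j) = 1/j], and [2j] is prime to the odd
    prime [p] exactly when [j] is. *)
Lemma invpoly_even p n : (2 < p)%N -> prime p ->
  invpoly p (2 * n).+1 1 + (invpoly p (2 * n).+1 1 \Po - 'X) =
  invpoly p n.+1 1 \Po 'X^2.
Proof.
move=> p2 pr; apply/polyP=> i.
rewrite coefD coef_comp_opp coef_comp_poly_Xn // !coef_poly !expr1 dvdn2.
rewrite -signr_odd; case: (boolP (odd i)) => oi /=.
  by case: ifP => _; rewrite ?mulr0 ?addr0 // mulN1r subrr.
have -> : i = (2 * (i %/ 2))%N by rewrite mulnC divnK // dvdn2.
rewrite mulKn // !ltnS leq_pmul2l //.
case: ifP => _; last by rewrite ?mulr0 ?addr0.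
by rewrite expr0 mul1r -[RHS](cinv_double _ p2 pr) mulr_natl mulr2n.
Qed.

(** Write [g(x) = f(-x)]. A coefficient at an even index is unchanged by [x -> -x], so [f^4] and
    [g^4] agree at [2n], and so do [f^3 g] and [f g^3]. The expansion of [(f + g)^4] at [2n] then
    reads [T4 p n = 2 T4 p (2n) + 8 S1 + 6 S2], with [S1], [S2] the two signed sums; half of it is
    the claim. *)
Lemma alternating_sum4E p n : (2 < p)%N -> prime p ->
  4%:R * sum4 p (2 * n)%N (fun i1 i2 i3 i4 =>
      (-1) ^+ i1 / (i1%:R * i2%:R * i3%:R * i4%:R))
    + 3%:R * sum4 p (2 * n)%N (fun i1 i2 i3 i4 =>
      (-1) ^+ (i1 + i2)%N / (i1%:R * i2%:R * i3%:R * i4%:R))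
  = T4 p n / 2%:R - T4 p (2 * n).
Proof.
move=> p2 pr; set f := invpoly p (2 * n).+1 1; set g : {poly rat} := f \Po - 'X.
have Eg : g = \poly_(i < (2 * n).+1) ((-1) ^+ i * cinv p i).
  apply/polyP=> i; rewrite coef_comp_opp !coef_poly expr1.
  by case: ifP => _; rewrite ?mulr0.
have Ef : f = \poly_(i < (2 * n).+1) (1 * cinv p i).
  by apply/polyP=> i; rewrite !coef_poly expr1 mul1r.
have p1 : (1 < p)%N by apply: ltnW.
have -> : sum4 p (2 * n)%N (fun i1 i2 i3 i4 =>
      (-1) ^+ i1 / (i1%:R * i2%:R * i3%:R * i4%:R)) = (g * f * f * f)`_(2 * n).
  have := sum4_coef (2 * n) (fun i => (-1) ^+ i) (fun=> 1) (fun=> 1) (fun=> 1) p1.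
  rewrite -Ef -Eg => <-.
  by do 4!(apply: eq_bigr => ? _); rewrite !mulr1.
have -> : sum4 p (2 * n)%N (fun i1 i2 i3 i4 =>
      (-1) ^+ (i1 + i2) / (i1%:R * i2%:R * i3%:R * i4%:R)) = (g * g * f * f)`_(2 * n).
  have := sum4_coef (2 * n) (fun i => (-1) ^+ i) (fun i => (-1) ^+ i) (fun=> 1) (fun=> 1) p1.
  rewrite -Ef -Eg => <-.
  by do 4!(apply: eq_bigr => ? _); rewrite !mulr1 exprD.
have refl (u : {poly rat}) : (u \Po - 'X)`_(2 * n) = u`_(2 * n).
  by rewrite coef_comp_opp -signr_odd oddM mul1r.
have ggg : g \Po - 'X = f.
  by apply/polyP=> i; rewrite !coef_comp_opp mulrA -expr2 sqrr_sign mul1r.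
have E1 : (g ^+ 3 * f)`_(2 * n) = (g * f * f * f)`_(2 * n).
  by rewrite -refl rmorphM rmorphXn /= ggg -/g; congr (nth 0 (polyseq _) _); ring.
have E2 : (g ^+ 4)`_(2 * n) = (f ^+ 4)`_(2 * n).
  by rewrite -refl rmorphXn /= ggg.
have E3 : ((f + g) ^+ 4)`_(2 * n) = T4 p n.
  rewrite invpoly_even // -rmorphXn /= coef_comp_poly_Xn // dvdn_mulr // mulKn //.
have : ((f + g) ^+ 4)`_(2 * n) = (f ^+ 4)`_(2 * n) + (g ^+ 4)`_(2 * n)
   + 4 * (g * f * f * f)`_(2 * n) + 4 * (g ^+ 3 * f)`_(2 * n)
   + 6 * (g * g * f * f)`_(2 * n).
  rewrite !mulr_natl -!coefMn -!coefD; congr (nth 0 (polyseq _) _); ring.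
rewrite E3 E2 E1 => ->; rewrite /T4 -/f.
by field.
Qed.

(** * Truncated power series *)

(** Congruence modulo [X^n]. *)
Definition eqX (n : nat) (u v : {poly rat}) := forall i, (i < n)%N -> u`_i = v`_i.

Lemma eqX_trans n u v w : eqX n u v -> eqX n v w -> eqX n u w.
Proof. by move=> h k i hi; rewrite h ?k. Qed.

Lemma eqXM n u v u' v' : eqX n u v -> eqX n u' v' -> eqX n (u * u') (v * v').
Proof.
move=> h h' i hi; rewrite !coefM; apply: eq_bigr => j _.
rewrite h ?h' //; last by apply: leq_ltn_trans hi; rewrite -ltnS.
by apply: leq_ltn_trans hi; rewrite leq_subr.
Qed.

Lemma eqXB n u v u' v' : eqX n u v -> eqX n u' v' -> eqX n (u - u') (v - v').
Proof. by move=> h h' i hi; rewrite !coefB h ?h'. Qed.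

(** For [k = 0] this is [1/(1 - X)] modulo [X^n], since [0 ^ 0 = 1]. *)
Definition powsum_poly (n k : nat) : {poly rat} := \poly_(a < n) a%:R ^+ k.

(** This is [1/(1 - X)^(k+1)] modulo [X^n]. *)
Definition binpoly (n k : nat) : {poly rat} := \poly_(a < n) 'C(a + k, k)%:R.

Lemma powsum_poly0_binpoly n k :
  eqX n (powsum_poly n 0 * binpoly n k) (binpoly n k.+1).
Proof.
move=> j hj; rewrite coefMr coef_poly hj.
elim: j hj => [|j IHj] hj.
  by rewrite big_ord1 !coef_poly hj expr0 mul1r !add0n !binn.
rewrite big_ord_recr /= subnn.
have -> : \sum_(i < j.+1) (powsum_poly n 0)`_(j.+1 - i) * (binpoly n k)`_i
   = \sum_(i < j.+1) (powsum_poly n 0)`_(j - i) * (binpoly n k)`_i.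
  apply: eq_bigr => i _; rewrite !coef_poly !expr0.
  by rewrite !(leq_ltn_trans (leq_subr _ _)) // ltnW.
rewrite IHj 1?ltnW // !coef_poly hj (leq_ltn_trans _ hj) // expr0 mul1r.
by rewrite -natrD !addSn !addnS [in RHS]binS.
Qed.

Lemma powsum_poly0_exp n k : eqX n (powsum_poly n 0 ^+ k.+1) (binpoly n k).
Proof.
elim: k => [|k IH]; first by move=> i hi; rewrite expr1 !coef_poly hi expr0 addn0 bin0.
by rewrite exprS; apply: eqX_trans (powsum_poly0_binpoly (n := n) k); apply: eqXM.
Qed.

Lemma powsum_poly1E n :
  eqX n (powsum_poly n 1) ('X * powsum_poly n 0 ^+ 2).
Proof.
move=> i hi; rewrite coefXM; case: i hi => [|i] hi; rewrite coef_poly hi ?expr1 //=.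
by rewrite powsum_poly0_exp 1?ltnW // coef_poly ltnW // bin1 addn1.
Qed.

(** The series is [X (1 + X)/(1 - X)^3], and [X (1 + X) = 2 X - X (1 - X)]. *)
Lemma powsum_poly2E n :
  eqX n (powsum_poly n 2)
        (2%:R * ('X * powsum_poly n 0 ^+ 3) - 'X * powsum_poly n 0 ^+ 2).
Proof.
move=> i hi; rewrite coefB mulr_natl coefMn !coefXM.
case: i hi => [|i] hi; rewrite coef_poly hi /=; first by rewrite expr2 !mul0r subr0.
rewrite !powsum_poly0_exp 1?ltnW // !coef_poly ltnW // bin1 addn1.
have E : ('C(i + 2, 2) * 2 = i.+2 * i.+1)%N.
  by rewrite -[X in (_ * X)%N]/(2`!) bin_ffact addn2 ffactnS ffactn1.
by rewrite -mulrnA E natrM -[i.+2]addn1 -[i.+1]addn1 !natrD; ring.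
Qed.

Lemma coefM_comp_Xn (u v : {poly rat}) Q m : (0 < Q)%N ->
  (u * (v \Po 'X^Q))`_m =
  \sum_(a < size v) v`_a * (if (m < a * Q)%N then 0 else u`_(m - a * Q)).
Proof.
move=> Q0; rewrite comp_polyE mulr_sumr coef_sum; apply: eq_bigr => a _.
by rewrite -scalerAr coefZ -exprM coefMXn mulnC.
Qed.

Lemma coefM_comp_Xn_small (u v : {poly rat}) Q m : (0 < Q)%N ->
  (size u <= Q)%N -> (u * (v \Po 'X^Q))`_m = u`_(m %% Q) * v`_(m %/ Q).
Proof.
move=> Q0 su; rewrite coefM_comp_Xn //.
have E a : (a == m %/ Q)%N = false ->
    (if (m < a * Q)%N then 0 else u`_(m - a * Q)) = 0.
  move=> ne; case: ltnP => // le; apply: nth_default; apply: leq_trans su _.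
  rewrite leqNgt; apply/negP => lt; move/negP: ne; apply.
  rewrite [X in _ == (X %/ _)%N](_ : m = a * Q + (m - a * Q))%N; last by rewrite subnKC.
  by rewrite divnMDl // (divn_small lt) addn0.
case: (ltnP (m %/ Q) (size v)) => h.
  rewrite (bigD1 (Ordinal h)) //= big1 => [|a ne].
    rewrite addr0 ltnNge leq_trunc_div /= mulrC; congr (nth 0 (polyseq u) _ * _).
    by rewrite [X in (X - _)%N](divn_eq m Q) addKn.
  by rewrite E ?mulr0 //; apply: negbTE.
rewrite [v`_(m %/ Q)]nth_default // mulr0 big1 // => a _; rewrite E ?mulr0 //.
by apply: ltn_eqF; apply: leq_trans h.
Qed.

(** Only coefficients of [u] at multiples of [Q] enter; index 0 and indices from [4 Q] on contribute
    nothing, which leaves [Q], [2 Q], [3 Q]. *)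
Lemma coefM_comp_Xn_mul (u v : {poly rat}) Q n : (0 < Q)%N -> u`_0 = 0 ->
  (size u <= 4 * Q)%N ->
  (u * (v \Po 'X^Q))`_(n.+3 * Q) =
  u`_Q * v`_n.+2 + u`_(2 * Q) * v`_n.+1 + u`_(3 * Q) * v`_n.
Proof.
move=> Q0 u0 su; rewrite coefM_comp_Xn //.
set F := fun a => v`_a * (if (n.+3 * Q < a * Q)%N then 0 else u`_(n.+3 * Q - a * Q)).
(* The range is enlarged by zero terms so that it contains [n], [n+1], [n+2] whatever the size of
   [v]. *)
have E : \sum_(a < size v) F a = \sum_(a < maxn (size v) n.+4) F a.
  rewrite (big_ord_widen _ F (leq_maxl (size v) n.+4)) big_mkcond.
  apply: eq_bigr => a _; case: ltnP => // h.
  by rewrite /F nth_default // mul0r.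
rewrite -/(F _) E.
have F0 a : a != n.+2 -> a != n.+1 -> a != n -> F a = 0.
  move=> n2 n1 n0; rewrite /F ltn_pmul2r // -mulnBl.
  case: ltnP => h; rewrite ?mulr0 //.
  have [->|ne] := eqVneq a n.+3; first by rewrite subnn mul0n u0 mulr0.
  rewrite [u`_ _]nth_default ?mulr0 //; apply: leq_trans su _.
  by rewrite leq_pmul2r //; lia.
have hm k : (k < n.+4)%N -> (k < maxn (size v) n.+4)%N by move=> h; rewrite leq_max h orbT.
rewrite (bigD1 (Ordinal (hm n.+2 (leqnSn _)))) //=.
rewrite (bigD1 (Ordinal (hm n.+1 (leqW (leqnSn _))))) /=; last first.
  by rewrite -val_eqE /=; lia.
rewrite (bigD1 (Ordinal (hm n (leqW (leqW (leqnSn _)))))) /=; last first.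
  by rewrite -!val_eqE /=; lia.
rewrite big1 => [|a /andP[/andP[h2 h1] h0]]; last by apply: F0; rewrite -val_eqE in h0 h1 h2.
rewrite /F !ltn_pmul2r // -!mulnBl.
have -> : (n.+3 < n)%N = false by lia.
have -> : (n.+3 < n.+1)%N = false by lia.
have -> : (n.+3 < n.+2)%N = false by lia.
rewrite /=.
have -> : (n.+3 - n = 3)%N by lia.
have -> : (n.+3 - n.+1 = 2)%N by lia.
have -> : (n.+3 - n.+2 = 1)%N by lia.
by rewrite mul1n; ring.
Qed.

Lemma coefM_comp_Xn_mul2 (u v : {poly rat}) Q : (0 < Q)%N -> u`_0 = 0 ->
  (u * (v \Po 'X^Q))`_(2 * Q) = u`_Q * v`_1 + u`_(2 * Q) * v`_0.
Proof.
move=> Q0 u0; rewrite coefM_comp_Xn //.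
set F := fun a => v`_a * (if (2 * Q < a * Q)%N then 0 else u`_(2 * Q - a * Q)).
have E : \sum_(a < size v) F a = \sum_(a < maxn (size v) 3) F a.
  rewrite (big_ord_widen _ F (leq_maxl (size v) 3)) big_mkcond.
  apply: eq_bigr => a _; case: ltnP => // h.
  by rewrite /F nth_default // mul0r.
rewrite -/(F _) E -(big_mkord xpredT F) (big_cat_nat _ (n := 3)) ?leq_maxr //=.
rewrite [X in _ + X]big1_seq ?addr0 => [|a]; last first.
  rewrite mem_index_iota /= => /andP[h _]; rewrite /F ltn_pmul2r //.
  by rewrite h mulr0.
rewrite !big_nat_recr //= big_nil /F !ltn_pmul2r //= -!mulnBl u0.
by rewrite subn0 (_ : 2 - 1 = 1)%N // mul1n; ring.
Qed.

(** * Expansion of T4 p (n * Q) *)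

Ltac rpred_tac := repeat (first [
  match goal with
  | |- is_true (in_mem (_ - _) _) => apply: rpredB
  | |- is_true (in_mem (_ + _) _) => apply: rpredD
  | |- is_true (in_mem (- _) _) => rewrite rpredN
  | |- is_true (in_mem (_ ^+ _) _) => apply: rpredX
  | |- is_true (in_mem (_ * _) _) => apply: rpredM
  | |- is_true (in_mem (_ %:R) _) => apply: rpred_nat
  end | assumption]).

Lemma coef_natM (n i : nat) (u : {poly rat}) : (n%:R * u)`_i = n%:R * u`_i.
Proof. by rewrite !mulr_natl coefMn. Qed.

(** * Reciprocals prime to p under shift and reflection *)

Section Coprime.
Variable p : nat.
Hypothesis p_prime : prime p.

Lemma coprime0p : coprime 0 p = false.
Proof. by rewrite /coprime gcd0n; case: eqP p_prime => // ->. Qed.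

Lemma pint_cinv i : cinv p i \in pint p.
Proof. by rewrite /cinv; case: ifP => [/pint_natV //|_]; apply: rpred0. Qed.

Lemma cinv_dvd i : (p %| i)%N -> cinv p i = 0.
Proof. by rewrite /cinv coprime_sym prime_coprime // => ->. Qed.

(** Geometric expansion of [1/(e + y)] in [e], with an exact remainder. When [p] divides [y], every
    term is 0. *)
Lemma cinv_shift e y : (p %| e)%N ->
  cinv p (e + y) = cinv p y - e%:R * cinv p y ^+ 2 + e%:R ^+ 2 * cinv p y ^+ 3
                   - e%:R ^+ 3 * (cinv p y ^+ 3 * cinv p (e + y)).
Proof.
move=> pe; rewrite /cinv.
have -> : coprime (e + y) p = coprime y p.
  by rewrite ![coprime _ p]coprime_sym !prime_coprime // dvdn_addr.
case: ifP => cy; last by ring.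
have y0 : (0 < y)%N by case: y cy => //; rewrite coprime0p.
have e0 : (0 < e + y)%N by rewrite addn_gt0 y0 orbT.
move: e0 y0; rewrite natrD -!(ltr0n rat) natrD => e0 y0.
by field; rewrite !lt0r_neq0.
Qed.

(** This is [1/(Q - y) = -1/y + Q/(y (Q - y))]. Substituting the identity into its own last term
    gives expansions to higher order in [Q]; later proofs rewrite with it repeatedly for this
    purpose. *)
Lemma cinv_rev Q y : (p %| Q)%N -> (y <= Q)%N ->
  cinv p (Q - y) = - cinv p y + Q%:R * (cinv p y * cinv p (Q - y)).
Proof.
move=> pQ yQ; rewrite /cinv.
have -> : coprime (Q - y) p = coprime y p.
  by rewrite ![coprime _ p]coprime_sym !prime_coprime // dvdn_subr.
case: ifP => cy; last by ring.
have y0 : (0 < y)%N by case: y cy {yQ} => //; rewrite coprime0p.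
have e0 : (0 < Q - y)%N.
  rewrite subn_gt0 ltn_neqAle yQ andbT; apply: contraTneq cy => ->.
  by rewrite coprime_sym prime_coprime // pQ.
move: e0 y0; rewrite -!(ltr0n rat) natrB // => e0 y0.
by field; rewrite !lt0r_neq0.
Qed.

Lemma invpoly_over n k : invpoly p n k \is a polyOver (pint p).
Proof. by apply: polyOver_poly => i _; rewrite rpredX ?pint_cinv. Qed.

Lemma powsum_poly_over n k : powsum_poly n k \is a polyOver (pint p).
Proof. by apply: polyOver_poly => i _; rewrite rpredX ?rpred_nat. Qed.

Lemma comp_Xn_over (u : {poly rat}) Q : (0 < Q)%N ->
  u \is a polyOver (pint p) -> u \Po 'X^Q \is a polyOver (pint p).
Proof.
move=> Q0 /polyOverP hu; apply/polyOverP => i.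
by rewrite coef_comp_poly_Xn //; case: ifP => // _; apply: rpred0.
Qed.

Lemma invpolyS n k : (p %| n)%N -> invpoly p n.+1 k.+1 = invpoly p n k.+1.
Proof.
move=> pn; apply/polyP=> i; rewrite !coef_poly ltnS leq_eqVlt.
by case: eqP => [->|//]; rewrite ltnn cinv_dvd // expr0n.
Qed.

Lemma coef0_invpoly n k : (invpoly p n k.+1)`_0 = 0.
Proof. by rewrite coef_poly cinv_dvd ?expr0n ?if_same. Qed.

Lemma size_invpoly n k : (size (invpoly p n k) <= n)%N.
Proof. exact: size_poly. Qed.

End Coprime.

Section Expansion.
Variables p Q : nat.
Hypothesis p_prime : prime p.
Hypothesis Q_gt0 : (0 < Q)%N.
Hypothesis p_dvd_Q : (p %| Q)%N.

Let A := invpoly p Q 1.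
Let B := invpoly p Q 2.
Let C := invpoly p Q 3.
Let E n k := powsum_poly n k \Po 'X^Q.

(** [cinv_shift] is applied to [i = a Q + y], with [a] and [y] the quotient and the remainder of [i]
    by [Q]. Each resulting term factors into a function of [y] and one of [a], hence into a product
    with a polynomial in [X^Q]. *)
Lemma invpoly_expand n : exists2 R : {poly rat}, R \is a polyOver (pint p)
  & invpoly p (n * Q) 1 =
    A * E n 0 - Q%:R * (B * E n 1) + Q%:R ^+ 2 * (C * E n 2) + Q%:R ^+ 3 * R.
Proof.
exists (\poly_(i < n * Q)
   (- (i %/ Q)%:R ^+ 3 * (cinv p (i %% Q) ^+ 3 * cinv p i))).
  apply: polyOver_poly => i _.
  by rewrite !(rpredM, rpredX, rpredN) ?rpred_nat ?pint_cinv.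
apply/polyP=> i; rewrite -!natrX coefD coefD coefB !coef_natM.
rewrite !coefM_comp_Xn_small ?size_invpoly // !coef_poly ltn_mod Q_gt0.
rewrite ltn_divLR //; case: ltnP => hi; last by rewrite !mulr0; ring.
have := @cinv_shift p p_prime (i %/ Q * Q) (i %% Q).
rewrite -divn_eq => /(_ (dvdn_mull _ p_dvd_Q)) E0; rewrite expr1 {1}E0 natrM !natrX.
by ring.
Qed.

Lemma invpoly_expand_exp4 n : exists2 R : {poly rat}, R \is a polyOver (pint p)
  & invpoly p (n * Q) 1 ^+ 4 =
    A ^+ 4 * ((powsum_poly n 0 ^+ 4) \Po 'X^Q)
    - 4%:R * (Q%:R * (A ^+ 3 * B * ((powsum_poly n 0 ^+ 3 * powsum_poly n 1) \Po 'X^Q)))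
    + (Q ^ 2)%:R *
      (4%:R * (A ^+ 3 * C * ((powsum_poly n 0 ^+ 3 * powsum_poly n 2) \Po 'X^Q))
       + 6%:R * (A ^+ 2 * B ^+ 2 * ((powsum_poly n 0 ^+ 2 * powsum_poly n 1 ^+ 2) \Po 'X^Q)))
    + (Q ^ 3)%:R * R.
Proof.
have [R hR ->] := invpoly_expand n.
have hE k : E n k \is a polyOver (pint p).
  by apply: comp_Xn_over => //; apply: powsum_poly_over.
have hA k : invpoly p Q k \is a polyOver (pint p) by apply: invpoly_over.
pose q : {poly rat} := Q%:R.
have hq : q \is a polyOver (pint p) by apply: rpred_nat.
pose U := A * E n 0; pose V := - (B * E n 1); pose W := C * E n 2.
pose Y := V + q * W + q ^+ 2 * R.
(* The expanded polynomial is [U + q Y]. The witness collects the terms of [(U + q Y)^4] from order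
   [q^3] on, divided by [q^3]. *)
exists (4%:R * U ^+ 3 * R
  + 6%:R * U ^+ 2 * (2%:R * V * (W + q * R) + q * (W + q * R) ^+ 2)
  + 4%:R * U * Y ^+ 3 + q * Y ^+ 4).
  have hU : U \is a polyOver (pint p) by apply: rpredM (hA 1%N) (hE 0%N).
  have hV : V \is a polyOver (pint p) by rewrite rpredN; apply: rpredM (hA 2%N) (hE 1%N).
  have hW : W \is a polyOver (pint p) by apply: rpredM (hA 3%N) (hE 2%N).
  have hY : Y \is a polyOver (pint p) by rewrite /Y; rpred_tac.
  by rpred_tac.
have cX (u : {poly rat}) m : (u ^+ m) \Po 'X^Q = (u \Po 'X^Q) ^+ m.
  exact: (rmorphXn (comp_poly 'X^Q)).
by rewrite !(cX, comp_polyM) /Y /U /V /W /q -!/(E _ _) !natrX; ring.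
Qed.

(** The polynomials in [X^Q] are combinations of [X^i/(1 - X)^m], whence the binomial coefficients.
    Taking [n >= 5] keeps the smallest index used, [n - 3], at least 2, so that the factors [X] can
    be split off. *)
Lemma T4_expand k : let n := k.+4.+1 in
  let a s := (A ^+ 4)`_(s * Q) in let b s := (A ^+ 3 * B)`_(s * Q) in
  let c s := (A ^+ 3 * C)`_(s * Q) in let d s := (A ^+ 2 * B ^+ 2)`_(s * Q) in
  exists2 z, z \in pint p &
  T4 p (n * Q) =
   a 1%N * 'C(n.+2, 3)%:R + a 2%N * 'C(n.+1, 3)%:R + a 3%N * 'C(n, 3)%:R
   - 4%:R * (Q%:R * (b 1%N * 'C(n.+2, 4)%:R + b 2%N * 'C(n.+1, 4)%:R
                     + b 3%N * 'C(n, 4)%:R))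
   + Q%:R ^+ 2 *
     (4%:R * (c 1%N * (2%:R * 'C(n.+3, 5)%:R - 'C(n.+2, 4)%:R)
            + c 2%N * (2%:R * 'C(n.+2, 5)%:R - 'C(n.+1, 4)%:R)
            + c 3%N * (2%:R * 'C(n.+1, 5)%:R - 'C(n, 4)%:R))
     + 6%:R * (d 1%N * 'C(n.+2, 5)%:R + d 2%N * 'C(n.+1, 5)%:R + d 3%N * 'C(n, 5)%:R))
   + Q%:R ^+ 3 * z.
Proof.
move=> n a b c d.
have [R hR ER] := invpoly_expand_exp4 n.
exists R`_(n * Q); first by move/polyOverP: hR.
rewrite /T4 invpolyS ?dvdn_mull // ER !(coefD, coefN, coef_natM).
have A0 : A`_0 = 0 by apply: coef0_invpoly.
have sM (u v : {poly rat}) s t :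
    (size u <= s * Q -> size v <= t * Q -> size (u * v)%R <= (s + t) * Q)%N.
  move=> hu hv; apply: leq_trans (size_polyMleq _ _) _.
  by rewrite mulnDl (leq_trans (leq_pred _)) // leq_add.
have sA : (size A <= 1 * Q)%N by rewrite mul1n size_invpoly.
have sB : (size B <= 1 * Q)%N by rewrite mul1n size_invpoly.
have sC : (size C <= 1 * Q)%N by rewrite mul1n size_invpoly.
have sA2 : (size (A ^+ 2)%R <= 2 * Q)%N by rewrite expr2; apply: (sM _ _ 1%N 1%N).
have sB2 : (size (B ^+ 2)%R <= 2 * Q)%N by rewrite expr2; apply: (sM _ _ 1%N 1%N).
have sA3 : (size (A ^+ 3)%R <= 3 * Q)%N by rewrite exprS; apply: (sM _ _ 1%N 2%N).
have sA4 : (size (A ^+ 4)%R <= 4 * Q)%N by rewrite exprS; apply: (sM _ _ 1%N 3%N).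
have X0 (u : {poly rat}) m : (A ^+ m.+1 * u)`_0 = 0.
  by rewrite coef0M exprS coef0M A0 !mul0r.
have e04 : eqX n (powsum_poly n 0 ^+ 4) (binpoly n 3) by apply: powsum_poly0_exp.
have e031 : eqX n (powsum_poly n 0 ^+ 3 * powsum_poly n 1) ('X * binpoly n 4).
  apply: (@eqX_trans _ _ (powsum_poly n 0 ^+ 3 * ('X * powsum_poly n 0 ^+ 2))).
    by apply: eqXM => //; apply: powsum_poly1E.
  by rewrite mulrCA -exprD; apply: eqXM => //; apply: powsum_poly0_exp.
have e032 : eqX n (powsum_poly n 0 ^+ 3 * powsum_poly n 2)
    (2%:R * ('X * binpoly n 5) - 'X * binpoly n 4).
  apply: (@eqX_trans _ _ (powsum_poly n 0 ^+ 3 *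
     (2%:R * ('X * powsum_poly n 0 ^+ 3) - 'X * powsum_poly n 0 ^+ 2))).
    by apply: eqXM => //; apply: powsum_poly2E.
  rewrite mulrBr mulrCA ![powsum_poly n 0 ^+ 3 * ('X * _)]mulrCA -!exprD.
  by apply: eqXB; do ?(apply: eqXM => //); apply: powsum_poly0_exp.
have e022 : eqX n (powsum_poly n 0 ^+ 2 * powsum_poly n 1 ^+ 2)
    ('X * ('X * binpoly n 5)).
  apply: (@eqX_trans _ _ (powsum_poly n 0 ^+ 2 * ('X * powsum_poly n 0 ^+ 2) ^+ 2)).
    by apply: eqXM => //; rewrite !expr2; apply: eqXM; apply: powsum_poly1E.
  rewrite (_ : _ * _ = 'X * ('X * powsum_poly n 0 ^+ 6)); last by ring.
  by do ?(apply: eqXM => //); apply: powsum_poly0_exp.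
have A40 : (A ^+ 4)`_0 = 0 by rewrite -[A ^+ 4]mulr1 X0.
have s31 (u : {poly rat}) : (size u <= 1 * Q -> size (A ^+ 3 * u)%R <= 4 * Q)%N.
  exact: (sM _ _ 3%N 1%N).
have s22 : (size (A ^+ 2 * B ^+ 2)%R <= 4 * Q)%N by apply: (sM _ _ 2%N 2%N).
rewrite !coefM_comp_Xn_mul ?X0 ?s31 //.
rewrite !e04 ?e031 ?e032 ?e022 /n //; try lia.
rewrite !(coefD, coefN, coef_natM) !coefXM /= !coef_poly.
rewrite -/n; do ?(rewrite ifT; last by rewrite /n; lia).
by rewrite -/n /a /b /c /d !mul1n !natrX !addnS !addn0; ring.
Qed.

End Expansion.

(** * The symmetry y -> Q - y *)

(* [u'] is [X^d u(1/X)] *)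
Definition is_rev (d : nat) (u u' : {poly rat}) :=
  [/\ (size u <= d.+1)%N, (size u' <= d.+1)%N
    & forall i, (i <= d)%N -> u'`_i = u`_(d - i)].

Lemma is_revM d e u u' v v' : is_rev d u u' -> is_rev e v v' ->
  is_rev (d + e) (u * v) (u' * v').
Proof.
move=> [su su' hu] [sv sv' hv].
have sM (x y : {poly rat}) : (size x <= d.+1 -> size y <= e.+1 ->
    size (x * y)%R <= (d + e).+1)%N.
  by move=> hx hy; apply: leq_trans (size_polyMleq _ _) _; lia.
split; [exact: sM | exact: sM |].
have Ex (x : {poly rat}) m : (size x <= m)%N -> x = \poly_(i < m) x`_i.
  by move=> sx; apply/polyP => i; rewrite coef_poly; case: ltnP => // h;
     rewrite nth_default // (leq_trans sx).
have Eu : u' = \sum_(i < d.+1) u`_i *: 'X^(d - i).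
  rewrite [LHS](Ex _ d.+1 su') poly_def (reindex_inj rev_ord_inj) /=.
  apply: eq_bigr => i _; rewrite subSS hu ?leq_subr //.
  by rewrite subKn // -ltnS.
have Ev : v' = \sum_(i < e.+1) v`_i *: 'X^(e - i).
  rewrite [LHS](Ex _ e.+1 sv') poly_def (reindex_inj rev_ord_inj) /=.
  apply: eq_bigr => i _; rewrite subSS hv ?leq_subr //.
  by rewrite subKn // -ltnS.
have Fu : u = \sum_(i < d.+1) u`_i *: 'X^i by rewrite -poly_def -Ex.
have Fv : v = \sum_(i < e.+1) v`_i *: 'X^i by rewrite -poly_def -Ex.
have Fuv : u * v =
  (\sum_(i < d.+1) u`_i *: 'X^i) * (\sum_(i < e.+1) v`_i *: 'X^i) by rewrite -Fu -Fv.
move=> m hm; rewrite Fuv Eu Ev.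
rewrite !mulr_suml !coef_sum; apply: eq_bigr => i _.
rewrite !mulr_sumr !coef_sum; apply: eq_bigr => j _.
rewrite -!scalerAl -!scalerAr !coefZ -!exprD !coefXn.
do 2!congr (_ * _); congr (_%:R); congr nat_of_bool.
have := ltn_ord i; have := ltn_ord j; rewrite !ltnS => hj hi.
by apply/eqP/eqP; lia.
Qed.

Section Symmetry.
Variables p Q : nat.
Hypothesis p_prime : prime p.
Hypothesis Q_gt0 : (0 < Q)%N.
Hypothesis p_dvd_Q : (p %| Q)%N.

Let A := invpoly p Q 1.
Let B := invpoly p Q 2.

Lemma T4_Q : T4 p Q = (A ^+ 4)`_(1 * Q).
Proof. by rewrite /T4 invpolyS // mul1n. Qed.

Lemma coef_pint (u : {poly rat}) i : u \is a polyOver (pint p) -> u`_i \in pint p.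
Proof. by move/polyOverP. Qed.

(** The case [n = 2], to order [Q^2] only: it trades the coefficient of [A^4] at [2 Q] for
    [T4 p (2 * Q)]. *)
Lemma T4_2Q : exists2 z, z \in pint p &
  T4 p (2 * Q) = (A ^+ 4)`_(2 * Q) + 4%:R * (A ^+ 4)`_(1 * Q)
    - 4%:R * (Q%:R * (A ^+ 3 * B)`_(1 * Q)) + Q%:R ^+ 2 * z.
Proof.
have [R hR ER] := invpoly_expand_exp4 p_prime Q_gt0 p_dvd_Q 2.
have hA k : invpoly p Q k \is a polyOver (pint p) by apply: invpoly_over.
have hE (u : {poly rat}) : u \is a polyOver (pint p) -> u \Po 'X^Q \is a polyOver (pint p).
  by move=> hu; apply: comp_Xn_over.
have hP k : powsum_poly 2 k \is a polyOver (pint p) by apply: powsum_poly_over.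
move: ER; set W2 := 4%:R * _ + 6%:R * _; move=> ER.
have hW : W2 \is a polyOver (pint p).
  by rewrite /W2; rpred_tac; try exact: hA; apply: hE; rpred_tac; exact: hP.
exists (W2`_(2 * Q) + Q%:R * R`_(2 * Q)).
  by apply: rpredD; [|apply: rpredM; [exact: rpred_nat|]]; apply: coef_pint.
rewrite /T4 invpolyS ?dvdn_mull // ER !(coefD, coefN, coef_natM) -/A -/B.
have A0 : A`_0 = 0 by apply: coef0_invpoly.
have X0 (u : {poly rat}) m : (A ^+ m.+1 * u)`_0 = 0.
  by rewrite coef0M exprS coef0M A0 !mul0r.
rewrite !coefM_comp_Xn_mul2 ?X0 //; last by rewrite -[A ^+ 4]mulr1 X0.
rewrite !powsum_poly0_exp // !coef_poly /=.
have e031 : eqX 2 (powsum_poly 2 0 ^+ 3 * powsum_poly 2 1) ('X * binpoly 2 4).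
  apply: (@eqX_trans _ _ (powsum_poly 2 0 ^+ 3 * ('X * powsum_poly 2 0 ^+ 2))).
    by apply: eqXM => //; apply: powsum_poly1E.
  by rewrite mulrCA -exprD; apply: eqXM => //; apply: powsum_poly0_exp.
rewrite !e031 // !coefXM /= !coef_poly /= !natrX mul1n.
have -> : 'C(1 + 3, 3) = 4%N by [].
rewrite !add0n !binn; ring.
Qed.

Lemma coef_invpoly_rev k i : (i <= Q)%N ->
  (invpoly p Q k.+1)`_(Q - i) = cinv p (Q - i) ^+ k.+1.
Proof.
move=> hi; rewrite coef_poly; case: ltnP => // h.
have -> : (Q - i = Q)%N by apply/eqP; rewrite eqn_leq h leq_subr.
by rewrite cinv_dvd // expr0n.
Qed.

Lemma coef_invpoly_le k i : (i <= Q)%N -> (invpoly p Q k.+1)`_i = cinv p i ^+ k.+1.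
Proof.
rewrite leq_eqVlt coef_poly => /orP[/eqP->|->//].
by rewrite ltnn cinv_dvd // expr0n.
Qed.

(** Two substitutions of [cinv_rev] give [1/(Q - y) = -(1/y + Q/y^2)] modulo [Q^2]. *)
Lemma rev_A : exists2 R, R \is a polyOver (pint p) &
  is_rev Q A (- (A + Q%:R * B) + Q%:R ^+ 2 * R).
Proof.
exists (\poly_(i < Q.+1) (cinv p i ^+ 2 * cinv p (Q - i))).
  by apply: polyOver_poly => i _; rewrite rpredM ?rpredX ?pint_cinv.
split; first by rewrite (leq_trans (size_invpoly _ _ _)).
  apply/leq_sizeP => i hi; rewrite -natrX !(coefD, coefN, coef_natM) !coef_poly.
  have -> : (i < Q.+1)%N = false by lia.
  by have -> : (i < Q)%N = false; [lia | ring].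
move=> i hi; rewrite coef_invpoly_rev // -natrX !(coefD, coefN, coef_natM).
rewrite !coef_invpoly_le // coef_poly ltnS hi expr1 natrX.
have E := cinv_rev p_prime p_dvd_Q hi; rewrite expr1 [RHS]E.
by rewrite [in RHS]E; ring.
Qed.

Lemma rev_B : exists2 R, R \is a polyOver (pint p) &
  is_rev Q B (B + Q%:R * R).
Proof.
exists (\poly_(i < Q.+1) (- 2%:R * (cinv p i ^+ 2 * cinv p (Q - i))
    + Q%:R * (cinv p i ^+ 2 * cinv p (Q - i) ^+ 2))).
  by apply: polyOver_poly => i _; rpred_tac; apply: pint_cinv.
split; first by rewrite (leq_trans (size_invpoly _ _ _)).
  apply/leq_sizeP => i hi; rewrite !(coefD, coef_natM) !coef_poly.
  have -> : (i < Q.+1)%N = false by lia.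
  by have -> : (i < Q)%N = false; [lia | ring].
move=> i hi; rewrite coef_invpoly_rev // !(coefD, coef_natM).
rewrite !coef_invpoly_le // coef_poly ltnS hi.
have E := cinv_rev p_prime p_dvd_Q hi; rewrite [X in _ = X ^+ 2]E; ring.
Qed.

(** Reversal in degree [4 Q] exchanges the coefficients at [Q] and [3 Q], and turns [A^4] into
    [(A + Q B)^4] modulo [Q^2]. *)
Lemma coef_A4_rev : exists2 z, z \in pint p &
  (A ^+ 4)`_(3 * Q) =
  (A ^+ 4)`_(1 * Q) + 4%:R * (Q%:R * (A ^+ 3 * B)`_(1 * Q)) + Q%:R ^+ 2 * z.
Proof.
have [R hR hA] := rev_A; pose q : {poly rat} := Q%:R.
have [_ _ h] : is_rev (Q + (Q + (Q + Q))) (A * (A * (A * A)))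
  ((- (A + q * B) + q ^+ 2 * R) * ((- (A + q * B) + q ^+ 2 * R)
    * ((- (A + q * B) + q ^+ 2 * R) * (- (A + q * B) + q ^+ 2 * R)))).
  by do 3!apply: is_revM => //.
have oA : A \is a polyOver (pint p) by apply: invpoly_over.
have oB : B \is a polyOver (pint p) by apply: invpoly_over.
have oq : q \is a polyOver (pint p) by apply: rpred_nat.
pose Z := 4%:R * A ^+ 3 * (- R) + 6%:R * A ^+ 2 * (B - q * R) ^+ 2
   + 4%:R * q * A * (B - q * R) ^+ 3 + q ^+ 2 * (B - q * R) ^+ 4.
have oZ : Z \is a polyOver (pint p) by rewrite /Z; rpred_tac.
exists Z`_(1 * Q); first exact: coef_pint.
have hle : (1 * Q <= Q + (Q + (Q + Q)))%N by lia.
have := h _ hle; have -> : (Q + (Q + (Q + Q)) - 1 * Q = 3 * Q)%N by lia.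
rewrite (_ : A * (A * (A * A)) = A ^+ 4); last by ring.
move=> <-; set L : {poly rat} := (X in (polyseq X)`_ _ = _).
have -> : L = A ^+ 4 + 4%:R * (Q%:R * (A ^+ 3 * B)) + (Q ^ 2)%:R * Z.
  by rewrite /L /Z natrX /q; ring.
by rewrite !(coefD, coef_natM) natrX.
Qed.

(** Reversal sends [A] to [-A] and [B] to [B] modulo [Q], so [A^3 B] is odd. For [s = 1] this
    relates the coefficients at [Q] and [3 Q]; for [s = 2] it forces the middle one to vanish modulo
    [Q]. *)
Lemma coef_A3B_rev s : (s <= 4)%N -> exists2 z, z \in pint p &
  (A ^+ 3 * B)`_((4 - s) * Q) = - (A ^+ 3 * B)`_(s * Q) + Q%:R * z.
Proof.
move=> s4.
have [R hR hA] := rev_A; have [R' hR' hB] := rev_B; pose q : {poly rat} := Q%:R.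
have [_ _ h] : is_rev (Q + (Q + (Q + Q))) (A * (A * (A * B)))
  ((- (A + q * B) + q ^+ 2 * R) * ((- (A + q * B) + q ^+ 2 * R)
    * ((- (A + q * B) + q ^+ 2 * R) * (B + q * R')))).
  by do 3!apply: is_revM => //.
have oA : A \is a polyOver (pint p) by apply: invpoly_over.
have oB : B \is a polyOver (pint p) by apply: invpoly_over.
have oq : q \is a polyOver (pint p) by apply: rpred_nat.
pose Y := B - q * R.
pose Z := - (A ^+ 3 * R' + (3%:R * A ^+ 2 * Y + 3%:R * q * A * Y ^+ 2 + q ^+ 2 * Y ^+ 3)
   * (B + q * R')).
have oY : Y \is a polyOver (pint p) by rewrite /Y; rpred_tac.
have oZ : Z \is a polyOver (pint p) by rewrite /Z; rpred_tac.
exists Z`_(s * Q); first exact: coef_pint.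
have hle : (s * Q <= Q + (Q + (Q + Q)))%N by nia.
have := h _ hle; have -> : (Q + (Q + (Q + Q)) - s * Q = (4 - s) * Q)%N by nia.
rewrite (_ : A * (A * (A * B)) = A ^+ 3 * B); last by ring.
move=> <-; set L : {poly rat} := (X in (polyseq X)`_ _ = _).
have -> : L = - (A ^+ 3 * B) + Q%:R * Z.
  by rewrite /L /Z /Y /q; ring.
by rewrite !(coefD, coefN, coef_natM).
Qed.

End Symmetry.

(** * The induction step *)

Lemma prime_dvd_fact p k : prime p -> (p %| k`!)%N -> (p <= k)%N.
Proof.
move=> pr; elim: k => [|k IH]; first by rewrite fact0 dvdn1; case: eqP pr => // ->.
rewrite factS Euclid_dvdM // => /orP[/dvdn_leq -> //|/IH]; exact: leqW.
Qed.

(** The falling factorial of [n + j] contains the factor [n] as [j < k], while [k!] is prime to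
    [p]. *)
Lemma prime_dvd_bin p n j k : prime p -> (p %| n)%N -> (j < k)%N -> (k < p)%N ->
  (p %| 'C(n + j, k))%N.
Proof.
move=> pr pn jk kp; have : (p %| 'C(n + j, k) * k`!)%N.
  rewrite bin_ffact ffact_prod (bigD1 (Ordinal jk)) //=.
  by rewrite addnK dvdn_mulr.
rewrite Euclid_dvdM // => /orP[//|/(prime_dvd_fact pr)].
by rewrite leqNgt kp.
Qed.

Lemma pdvd1_nat p n : (0 < p)%N -> (p %| n)%N -> n%:R \in pdvd p 1.
Proof.
move=> p0 /dvdnP[m ->]; apply/(pdvdP p0); exists m%:R; first exact: rpred_nat.
by rewrite natrM expr1 mulrC.
Qed.

Lemma bin3_rat m : 'C(m.+3, 3)%:R = (m%:R + 3) * (m%:R + 2) * (m%:R + 1) / 6 :> rat.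
Proof.
have E : ('C(m.+3, 3) * 6 = m.+3 * (m.+2 * m.+1))%N.
  by rewrite -[6%N]/(3`!) bin_ffact !ffactnS ffactn0 muln1.
have /eqP := congr1 (fun x => x%:R : rat) E.
rewrite !natrM -[m.+3]addn3 -[m.+2]addn2 -[m.+1]addn1 !natrD => /eqP E'.
by apply: (mulIf (_ : 6 != 0 :> rat)) => //; rewrite E'; field.
Qed.

Lemma bin4_rat m :
  'C(m.+4, 4)%:R = (m%:R + 4) * (m%:R + 3) * (m%:R + 2) * (m%:R + 1) / 24 :> rat.
Proof.
have E : ('C(m.+4, 4) * 24 = m.+4 * (m.+3 * (m.+2 * m.+1)))%N.
  by rewrite -[24%N]/(4`!) bin_ffact !ffactnS ffactn0 muln1.
have /eqP := congr1 (fun x => x%:R : rat) E.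
rewrite !natrM -[m.+4]addn4 -[m.+3]addn3 -[m.+2]addn2 -[m.+1]addn1 !natrD => /eqP E'.
by apply: (mulIf (_ : 24 != 0 :> rat)) => //; rewrite E'; field.
Qed.

(* The coefficient of Q^2 in the expansion of T4 p (n * Q). *)
Definition second_order (p Q n : nat) : rat :=
  let A := invpoly p Q 1 in let B := invpoly p Q 2 in let C := invpoly p Q 3 in
  let c s := (A ^+ 3 * C)`_(s * Q) in let d s := (A ^+ 2 * B ^+ 2)`_(s * Q) in
  4%:R * (c 1%N * (2%:R * 'C(n.+3, 5)%:R - 'C(n.+2, 4)%:R)
        + c 2%N * (2%:R * 'C(n.+2, 5)%:R - 'C(n.+1, 4)%:R)
        + c 3%N * (2%:R * 'C(n.+1, 5)%:R - 'C(n, 4)%:R))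
  + 6%:R * (d 1%N * 'C(n.+2, 5)%:R + d 2%N * 'C(n.+1, 5)%:R + d 3%N * 'C(n, 5)%:R).

Lemma pint_second_order p Q n : second_order p Q n \in pint p.
Proof.
have h k : invpoly p Q k \is a polyOver (pint p) by apply: invpoly_over.
by rewrite /second_order; rpred_tac; apply: coef_pint; rpred_tac; apply: h.
Qed.

(** For [p > 5] all the binomial coefficients involved are divisible by [p]. For [p = 5] those with
    lower index 5 escape this argument. *)
Lemma second_order_ge7 p Q n : prime p -> (5 < p)%N -> (p %| n)%N ->
  second_order p Q n \in pdvd p 1.
Proof.
move=> pr p5 pn; have p0 := prime_gt0 pr.
have h k : invpoly p Q k \is a polyOver (pint p) by apply: invpoly_over.
have c s : (invpoly p Q 1 ^+ 3 * invpoly p Q 3)`_(s * Q) \in pint p.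
  by apply: coef_pint; rpred_tac; apply: h.
have d s : (invpoly p Q 1 ^+ 2 * invpoly p Q 2 ^+ 2)`_(s * Q) \in pint p.
  by apply: coef_pint; rpred_tac; apply: h.
have b5 j : (j < 5)%N -> 'C(n + j, 5)%:R \in pdvd p 1.
  by move=> j5; apply: pdvd1_nat => //; apply: prime_dvd_bin.
have b4 j : (j < 4)%N -> 'C(n + j, 4)%:R \in pdvd p 1.
  by move=> j4; apply: pdvd1_nat => //; apply: prime_dvd_bin => //; apply: ltnW.
rewrite /second_order -[n.+3]addn3 -[n.+2]addn2 -[n.+1]addn1.
have b40 := b4 0%N isT; have b50 := b5 0%N isT; rewrite addn0 in b40 b50.
apply: rpredD; apply: (pdvdMl p0); rewrite ?rpred_nat //.
  by do ?(apply: rpredD); apply: (pdvdMl p0) => //; apply: rpredB;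
    rewrite ?b4 //; apply: (pdvdMl p0); rewrite ?b5 // rpred_nat.
by do ?(apply: rpredD); apply: (pdvdMl p0) => //; rewrite ?b5.
Qed.

(** The error terms have the factor [Q^2 = p^(2r)]. All but [second_order] carry another [p], from a
    binomial coefficient or from [Q], and [2r + 1 >= r + 2]. For [second_order] itself,
    [2r >= r + 2] suffices when [r > 1]; when [r = 1] it must supply a factor [p]. *)
Lemma T4_step p r n : prime p -> (5 <= p)%N -> (0 < r)%N -> (p %| n)%N -> (5 <= n)%N ->
  (1 < r)%N \/ second_order p (p ^ r) n \in pdvd p 1 ->
  T4 p (n * p ^ r) - (n%:R * (4 - n%:R ^+ 2) / 3 * T4 p (p ^ r)
     + n%:R * (n%:R ^+ 2 - 1) / 6 * T4 p (2 * p ^ r)) \in pdvd p r.+2.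
Proof.
move=> pr p5 r0 pn n5 h2; have p0 := prime_gt0 pr.
set Q := (p ^ r)%N in h2 *.
have Q0 : (0 < Q)%N by rewrite expn_gt0 p0.
have pQ : (p %| Q)%N by rewrite /Q -(prednK r0) expnS dvdn_mulr.
have n5E : n = (n - 5).+4.+1 by lia.
have bn j k : (j < k)%N -> (k < 5)%N -> 'C(n + j, k)%:R \in pdvd p 1.
  by move=> jk k5; apply: pdvd1_nat => //; apply: prime_dvd_bin => //; apply: leq_trans p5.
have bn0 k : (0 < k)%N -> (k < 5)%N -> 'C(n, k)%:R \in pdvd p 1.
  by move=> k0 k5; rewrite -(addn0 n); apply: bn.
have r2 : (r.+2 <= 2 * r + 1)%N by lia.
have r2' : (1 < r)%N -> (r.+2 <= 2 * r)%N by lia.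
have [z hz] := T4_expand pr Q0 pQ (n - 5); rewrite -n5E.
rewrite -/(second_order p Q n) => ET.
have [z2 hz2 E2] := T4_2Q pr Q0 pQ.
have E1 := T4_Q pr pQ.
have [z3 hz3 E3] := coef_A4_rev pr Q0 pQ.
have [z4 hz4 E4] := @coef_A3B_rev p Q pr Q0 pQ 1 isT.
have [z5 hz5 E5] := @coef_A3B_rev p Q pr Q0 pQ 2 isT.
move: E4 E5; rewrite (_ : 4 - 1 = 3)%N // (_ : 4 - 2 = 2)%N // => E4 E5.
move: ET E1 E2 E3 E4 E5.
pose A := invpoly p Q 1; pose B := invpoly p Q 2; rewrite -/A -/B.
set a1 := (A ^+ 4)`_(1 * Q); set a2 := (A ^+ 4)`_(2 * Q); set a3 := (A ^+ 4)`_(3 * Q).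
set b1 := (A ^+ 3 * B)`_(1 * Q); set b2 := (A ^+ 3 * B)`_(2 * Q).
set b3 := (A ^+ 3 * B)`_(3 * Q).
set y := second_order p Q n in h2 *.
move=> ET E1 E2 E3 E4 E5.
have Ey : y \in pint p by apply: pint_second_order.
have -> : T4 p (n * Q) - (n%:R * (4 - n%:R ^+ 2) / 3 * T4 p Q
     + n%:R * (n%:R ^+ 2 - 1) / 6 * T4 p (2 * Q)) =
  Q%:R ^+ 2 * (z3 * 'C(n, 3)%:R - z2 * 'C(n.+1, 3)%:R - 2%:R * z5 * 'C(n.+1, 4)%:R
   - 4%:R * z4 * 'C(n, 4)%:R + Q%:R * z) + Q%:R ^+ 2 * y.
  (* After [a2], [a3], [b2], [b3] are eliminated, [b1] drops out because
     [C(n+2,4) - C(n,4) = C(n+1,3) + C(n,3)]. *)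
  have a2E : a2 = T4 p (2 * Q) - 4%:R * a1 + 4%:R * (Q%:R * b1) - Q%:R ^+ 2 * z2.
    by rewrite E2; ring.
  have b2E : b2 = Q%:R * z5 / 2 by lra.
  rewrite ET E4 E3 b2E a2E E1.
  rewrite n5E; move: (n - 5)%N => k.
  rewrite !bin3_rat !bin4_rat -?(natr1 k.+4) -?(natr1 k.+3) -?(natr1 k.+2).
  by rewrite -?(natr1 k.+1) -?(natr1 k); field.
have hQ : Q%:R ^+ 2 \in pdvd p (2 * r).
  by apply/(pdvdP p0); exists 1; rewrite ?rpred1 // /Q natrX -exprM mulr1 mulnC.
rewrite -[n.+1]addn1; apply: rpredD.
  apply: (pdvd_leq p0 r2).
  apply: (pdvdM p0) => //.
  have hq : Q%:R * z \in pdvd p 1 by apply: (pdvdMr p0) => //; apply: pdvd1_nat.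
  apply: rpredD => //; do 3?(apply: rpredB); apply: (pdvdMl p0) => //; rewrite ?bn0 ?bn //;
    by apply: rpredM; rewrite ?rpred_nat.
case: h2 => h2.
  by apply: (pdvd_leq p0 (r2' h2)); apply: (pdvdMr p0).
by apply: (pdvd_leq p0 r2); apply: (pdvdM p0).
Qed.

(** * The logarithmic series *)

(** Truncation of [-log(1 - X)]; the constant term is 0 because [0^-1 = 0]. *)
Definition logpoly (M : nat) : {poly rat} := \poly_(i < M) i%:R^-1.

(** For [k > 0] the term [j = 0] vanishes, so the sum effectively runs over [0 < j < n]. *)
Definition hsum (n k : nat) : rat := \sum_(j < n) j%:R^-1 ^+ k.

Lemma hsumS n k : hsum n.+1 k = hsum n k + n%:R^-1 ^+ k.
Proof. by rewrite /hsum big_ord_recr. Qed.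

Lemma coef0_logpoly M : (logpoly M)`_0 = 0.
Proof. by rewrite coef_poly invr0 if_same. Qed.

(* From (1 - X) L' = 1 for the logarithmic series L. *)
Lemma coef_logpoly_rec M k i : (i.+1 < M)%N ->
  i.+1%:R * (logpoly M ^+ k.+1)`_i.+1 =
  i%:R * (logpoly M ^+ k.+1)`_i + k.+1%:R * (logpoly M ^+ k)`_i.
Proof.
move=> hi; have E : eqX M.-1 ((1 - 'X) * (logpoly M)^`()) 1.
  move=> j hj; rewrite mulrBl mul1r coefB coefXM !coef_deriv coef1.
  have hj1 : (j.+1 < M)%N by lia.
  rewrite coef_poly hj1 -[_ *+ j.+1]mulr_natr mulVf ?pnatr_eq0 //.
  case: j hj hj1 => [|j] hj hj1 /=; first by rewrite subr0.
  by rewrite coef_poly ltnW // -[_ *+ j.+1]mulr_natr mulVf ?pnatr_eq0 // subrr.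
have hi1 : (i < M.-1)%N by lia.
have := eqXM (fun j _ => erefl (k.+1%:R * logpoly M ^+ k)`_j) E hi1.
rewrite mulr1 coef_natM => <-.
have -> : k.+1%:R * logpoly M ^+ k * ((1 - 'X) * (logpoly M)^`()) =
   (1 - 'X) * (logpoly M ^+ k.+1)^`().
  by rewrite deriv_exp /= -mulr_natl; ring.
rewrite mulrBl mul1r coefB coefXM !coef_deriv -[_ *+ i.+1]mulr_natl.
case: i hi hi1 => [|i] hi hi1 /=; first by rewrite mulr0n; ring.
by rewrite -[_ *+ i.+1]mulr_natl; ring.
Qed.

Lemma divf_nat (x y : rat) i : i%:R * x = y -> (i = 0%N -> x = 0) -> x = y * i%:R^-1.
Proof.
case: i => [|i] E h; first by rewrite h // invr0 mulr0.
by rewrite -E mulrAC divff ?pnatr_eq0 // mul1r.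
Qed.

Lemma coef0_logpolyX M k : (logpoly M ^+ k.+1)`_0 = 0.
Proof. by rewrite exprS coef0M coef0_logpoly mul0r. Qed.

Lemma coef_logpoly2 M i : (i < M)%N -> i%:R * (logpoly M ^+ 2)`_i = 2 * hsum i 1.
Proof.
elim: i => [|i IH] hi; first by rewrite mul0r /hsum big_ord0 mulr0.
rewrite coef_logpoly_rec // IH 1?ltnW // expr1 coef_poly ltnW // hsumS expr1.
by ring.
Qed.

Lemma coef_logpoly3 M i : (i < M)%N ->
  i%:R * (logpoly M ^+ 3)`_i = 3 * (hsum i 1 ^+ 2 - hsum i 2).
Proof.
elim: i => [|i IH] hi; first by rewrite mul0r /hsum !big_ord0 expr0n subrr mulr0.
rewrite coef_logpoly_rec // IH 1?ltnW // !hsumS expr1.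
rewrite (divf_nat (coef_logpoly2 (ltnW hi))) => [|->]; last exact: coef0_logpolyX.
by ring.
Qed.

(** The bracket is [6 e_3(1, 1/2, ..., 1/(i-1))], the elementary symmetric function written in power
    sums; exponents 2 and 3 give [e_1] and [2 e_2] in the same way. *)
Lemma coef_logpoly4 M i : (i < M)%N ->
  i%:R * (logpoly M ^+ 4)`_i =
  4 * (hsum i 1 ^+ 3 - 3 * hsum i 1 * hsum i 2 + 2 * hsum i 3).
Proof.
elim: i => [|i IH] hi.
  by rewrite mul0r /hsum !big_ord0; ring.
rewrite coef_logpoly_rec // IH 1?ltnW // !hsumS expr1.
rewrite (divf_nat (coef_logpoly3 (ltnW hi))) => [|->]; last exact: coef0_logpolyX.
by ring.
Qed.

(** * T4 at p and 2p through harmonic sums *)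

Section Base.
Variable p : nat.
Hypothesis p_prime : prime p.
Let p_gt0 : (0 < p)%N := prime_gt0 p_prime.

(** Below [2p + 1] the multiples of [p] to be removed are [p] and possibly [2p]. The coefficient [e]
    can stay unspecified: in the coefficients used later it only meets constant terms of powers of
    [logpoly], which are 0. *)
Lemma invpoly_log M : (M <= (2 * p).+1)%N -> (p < M)%N ->
  exists e : rat, invpoly p M 1 = logpoly M - 'X^p * (p%:R^-1%:P + e *: 'X^p).
Proof.
move=> hM pM; exists (if (2 * p < M)%N then (2 * p)%:R^-1 else 0).
apply/polyP => i; rewrite coefB coefXnM !coef_poly expr1 coefD coefC coefZ coefXn.
case: (ltnP i p) => ip.
  rewrite subr0 (ltn_trans ip pM) /cinv.
  case: i ip => [|i] ip; first by rewrite coprime0p // invr0.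
  by rewrite coprime_sym prime_coprime // gtnNdvd.
case: (boolP (p %| i)%N) => [/dvdnP[m Em]|ndiv]; last first.
  have -> : (i - p == 0)%N = false.
    by apply/negP => /eqP h; move/negP: ndiv; apply; have -> : i = p by lia.
  have -> : (i - p == p)%N = false.
    apply/negP => /eqP h; move/negP: ndiv; apply; have -> : i = (p * 2)%N by lia.
    exact: dvdn_mulr.
  by rewrite /= mulr0 !addr0 ?subr0 /cinv coprime_sym prime_coprime // ndiv.
rewrite (cinv_dvd p_prime); last by rewrite Em dvdn_mull.
case: m Em => [|[|[|m]]] Em.
- by move: ip p_gt0; rewrite Em mul0n; lia.
- rewrite Em mul1n subnn eqxx pM; case: eqP p_gt0 => [<-//|_ _].
  by rewrite mulr0 addr0 subrr.
- rewrite Em; have -> : (2 * p - p = p)%N by lia.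
  have -> : (p == 0)%N = false by apply/negbTE; rewrite -lt0n.
  by rewrite eqxx mulr1 add0r; case: ifP => _; rewrite ?subrr ?subr0.
- have -> : (i < M)%N = false by rewrite Em; nia.
  have -> : (i - p == 0)%N = false by rewrite Em; nia.
  have -> : (i - p == p)%N = false by rewrite Em; nia.
  by rewrite /= mulr0 !addr0 ?subr0.
Qed.

Lemma T4_p : p%:R * T4 p p = 4 * (hsum p 1 ^+ 3 - 3 * hsum p 1 * hsum p 2 + 2 * hsum p 3).
Proof.
rewrite /T4; have [||e ->] := @invpoly_log p.+1; [lia|lia|].
set G := _%:P + _.
rewrite -(coef_logpoly4 (ltnSn p)); congr (_ * _); set L := logpoly _.
have -> : (L - 'X^p * G) ^+ 4 = L ^+ 4 + 'X^p * ((- 4%:R * (L ^+ 3 * G))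
   + 'X^p * (6%:R * (L ^+ 2 * G ^+ 2) - 4%:R * ('X^p * (L * G ^+ 3)) + 'X^p * ('X^p * G ^+ 4))).
  by ring.
rewrite coefD coefXnM ltnn subnn coefD coefXnM p_gt0 addr0.
by rewrite mulNr coefN coef_natM coef0M coef0_logpolyX mul0r mulr0 oppr0 addr0.
Qed.

Lemma T4_2p : T4 p (2 * p) =
  2 / p%:R * (hsum (2 * p) 1 ^+ 3 - 3 * hsum (2 * p) 1 * hsum (2 * p) 2 + 2 * hsum (2 * p) 3)
  - 12 / p%:R ^+ 2 * (hsum p 1 ^+ 2 - hsum p 2).
Proof.
have p0 : p%:R != 0 :> rat by rewrite pnatr_eq0 -lt0n.
rewrite /T4; have [||e ->] := @invpoly_log (2 * p).+1; [lia|lia|].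
set G := _%:P + _.
set L := logpoly _.
have -> : (L - 'X^p * G) ^+ 4 = L ^+ 4 + 'X^p * ((- 4%:R * (L ^+ 3 * G))
   + 'X^p * (6%:R * (L ^+ 2 * G ^+ 2) + 'X^p * (- 4%:R * (L * G ^+ 3) + 'X^p * G ^+ 4))).
  by ring.
rewrite coefD coefXnM ifF; last by lia.
have -> : (2 * p - p = p)%N by lia.
rewrite coefD coefXnM ltnn subnn coefD [in X in _ + (_ + X)]coefXnM p_gt0 addr0.
rewrite mulNr coefN !coef_natM [X in 6 * X]coef0M coef0_logpolyX mul0r mulr0 addr0.
have E4 := @coef_logpoly4 (2 * p).+1 (2 * p) (ltnSn _).
have E3 := @coef_logpoly3 (2 * p).+1 p.
have -> : (L ^+ 4)`_(2 * p) = 4 * (hsum (2 * p) 1 ^+ 3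
    - 3 * hsum (2 * p) 1 * hsum (2 * p) 2 + 2 * hsum (2 * p) 3) / (2 * p%:R).
  by rewrite -E4 natrM; field.
have -> : (L ^+ 3 * G)`_p = 3 * (hsum p 1 ^+ 2 - hsum p 2) / p%:R ^+ 2.
  rewrite mulrDr coefD mulrC mul_polyC coefZ -scalerAr coefZ coefMXn ltnn subnn.
  by rewrite coef0_logpolyX mulr0 addr0 -E3 -/L; [field | lia].
by field.
Qed.

End Base.

(** * Faulhaber's formula *)

(** Expand [(n + 1)^(k+1-j)] and exchange the sums. The inner sum at [n^l] is the Bernoulli
    recurrence of order [k - l], which vanishes for [l < k]; the term [l = k] leaves
    [(k + 1) n^k]. *)
Lemma faulhaber_step k (n : rat) :
  \sum_(j < k.+1) 'C(k.+1, j)%:R * bernoulli j * (n + 1) ^+ (k.+1 - j)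
  - \sum_(j < k.+1) 'C(k.+1, j)%:R * bernoulli j * n ^+ (k.+1 - j)
  = k.+1%:R * n ^+ k.
Proof.
rewrite -sumrB.
have E (j : 'I_k.+1) : true -> 'C(k.+1, j)%:R * bernoulli j * (n + 1) ^+ (k.+1 - j)
    - 'C(k.+1, j)%:R * bernoulli j * n ^+ (k.+1 - j) =
    \sum_(l < k.+1 | (l + j < k.+1)%N)
       'C(k.+1, l)%:R * n ^+ l * ('C(k.+1 - l, j)%:R * bernoulli j).
  move=> _; have jk := ltn_ord j; rewrite -mulrBr exprD1n big_ord_recr /= binn mulr1n addrK.
  rewrite mulr_sumr.
  have le : (k.+1 - j <= k.+1)%N by rewrite leq_subr.
  rewrite (big_ord_widen _
    (fun l => 'C(k.+1, j)%:R * bernoulli j * (n ^+ l *+ 'C(k.+1 - j, l))) le).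
  apply: eq_big => [l|l hl]; first by rewrite ltn_subRL addnC.
  have -> : 'C(k.+1, l)%:R * n ^+ l * ('C(k.+1 - l, j)%:R * bernoulli j)
     = ('C(k.+1, l) * 'C(k.+1 - l, j))%:R * (bernoulli j * n ^+ l) by rewrite natrM; ring.
  rewrite -mulr_natr.
  have -> : ('C(k.+1, l) * 'C(k.+1 - l, j) = 'C(k.+1, j) * 'C(k.+1 - j, l))%N.
    have hl' : (l <= k.+1)%N by lia.
    have hj' : (j <= k.+1)%N by lia.
    have h1 : (j <= k.+1 - l)%N by lia.
    have h2 : (l <= k.+1 - j)%N by lia.
    have F : (0 < (l`! * j`! * (k.+1 - l - j)`!))%N by rewrite !muln_gt0 !fact_gt0.
    apply/eqP; rewrite -(eqn_pmul2r F); apply/eqP.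
    have e1 := bin_fact hl'; have e2 := bin_fact hj'.
    have e3 := bin_fact h1; have e4 := bin_fact h2.
    have e5 : (k.+1 - j - l = k.+1 - l - j)%N by lia.
    rewrite e5 in e4.
    transitivity (k.+1)`!.
      by rewrite -e1 -e3; ring.
    by rewrite -e2 -e4; ring.
  by rewrite natrM; ring.
rewrite (eq_bigr _ E) (exchange_big_dep xpredT) //=.
rewrite big_ord_recr /= big1 ?add0r => [|l _].
  rewrite (bigD1 ord0) /=; last by rewrite addn0.
  rewrite big1 => [|j /andP[h1 h2]].
    by rewrite bernoulli0 bin0 binSn; ring.
  by exfalso; move: h1 h2; rewrite -val_eqE /=; lia.
rewrite -mulr_sumr; apply/eqP; rewrite mulf_eq0; apply/orP; right; apply/eqP.
have hl := ltn_ord l; have k0 : (0 < k - l)%N by rewrite subn_gt0.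
have le : ((k - l).+1 <= k.+1)%N by lia.
rewrite -[RHS](bernoulli_rec k0).
rewrite (big_ord_widen _ (fun j => 'C((k - l).+1, j)%:R * bernoulli j) le).
by apply: eq_big => [j|j _]; [lia | rewrite subSn // ltnW].
Qed.

Lemma faulhaber k n : k.+1%:R * \sum_(i < n) i%:R ^+ k =
  \sum_(j < k.+1) 'C(k.+1, j)%:R * bernoulli j * n%:R ^+ (k.+1 - j).
Proof.
elim: n => [|n IH].
  rewrite big_ord0 mulr0 big1 // => j _; rewrite subSn -1?ltnS //.
  by rewrite expr0n /= mulr0.
rewrite big_ord_recr /= mulrDr IH -(faulhaber_step k n%:R) natr1.
by rewrite addrC subrK.
Qed.

(** * Bernoulli numbers and power sums modulo p^2 *)

Section Harmonic.
Variable p : nat.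
Hypothesis p_prime : prime p.
Let p_gt0 : (0 < p)%N := prime_gt0 p_prime.

Lemma coprime_ltp d : (0 < d)%N -> (d < p)%N -> coprime d p.
Proof. by move=> d0 dp; rewrite coprime_sym prime_coprime // gtnNdvd. Qed.

(** Up to index [k] the recurrence only divides by integers at most [k + 1 < p]. *)
Lemma pint_bernoulli k : (k.+1 < p)%N -> bernoulli k \in pint p.
Proof.
elim/ltn_ind: k => -[|k] IH hk; first by rewrite bernoulli0 rpred1.
have := @bernoulli_rec k.+1 isT; rewrite big_ord_recr /= binSn => /eqP.
rewrite addr_eq0 eq_sym eqr_oppLR => /eqP E.
rewrite -pdvd0; apply: (@pdvd_unit _ _ _ k.+2) => //; first exact: coprime_ltp.
rewrite E pdvd0 rpredN; apply: rpred_sum => i _; apply: rpredM; first exact: rpred_nat.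
by have := ltn_ord i; move=> ik; apply: IH; lia.
Qed.

(** In Faulhaber's formula at [n = p], all terms but the last contain [p^2]. *)
Lemma power_sum_bernoulli k : (0 < k)%N -> (k.+1 < p)%N ->
  \sum_(i < p) i%:R ^+ k - p%:R * bernoulli k \in pdvd p 2.
Proof.
move=> k0 hk; apply: (@pdvd_unit _ p_gt0 _ k.+1) => //; first exact: coprime_ltp.
rewrite mulrBr faulhaber big_ord_recr /= binSn subSn // subnn expr1.
rewrite (_ : _ + _ - _ =
  \sum_(i < k) 'C(k.+1, i)%:R * bernoulli i * p%:R ^+ (k.+1 - i)); last by ring.
apply: rpred_sum => i _; have ik := ltn_ord i.
apply: (@pdvd_leq _ p_gt0 _ (k.+1 - i)); first by lia.
rewrite mulrC; apply: pdvdXp => //; apply: rpredM; first exact: rpred_nat.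
by apply: pint_bernoulli; lia.
Qed.

End Harmonic.

(** * Harmonic sums modulo powers of p *)

Section HarmonicCongruences.
Variable p : nat.
Hypothesis p_prime : prime p.
Let p_gt0 : (0 < p)%N := prime_gt0 p_prime.
Notation c := (cinv p).

Lemma cinv_ltp j : (j < p)%N -> c j = j%:R^-1.
Proof.
rewrite /cinv; case: j => [|j] hj; first by rewrite invr0 if_same.
by rewrite coprime_ltp.
Qed.

Lemma hsum_cinv k : hsum p k = \sum_(j < p) c j ^+ k.
Proof. by apply: eq_bigr => j _; rewrite cinv_ltp. Qed.

Lemma hsum_cinv_rev k : hsum p k.+1 = \sum_(j < p) c (p - j) ^+ k.+1.
Proof.
have E : \sum_(j < p.+1) c j ^+ k.+1 = \sum_(j < p) c j ^+ k.+1.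
  by rewrite big_ord_recr /= cinv_dvd // expr0n addr0.
rewrite hsum_cinv -E big_ord_recl /= cinv_dvd // expr0n add0r.
rewrite [RHS](reindex_inj rev_ord_inj) /=; apply: eq_bigr => j _.
by rewrite /bump add1n subKn.
Qed.

(** The index [p] is set apart, since [cinv] would send it to 0. *)
Lemma hsum_2p k : hsum (2 * p) k.+1 =
  hsum p k.+1 + p%:R^-1 ^+ k.+1 + \sum_(j < p) c (p + j) ^+ k.+1.
Proof.
rewrite /hsum mul2n -addnn big_split_ord /= -addrA; congr (_ + _).
case: p p_prime p_gt0 => [//|q] pr _; rewrite !big_ord_recl /= addn0.
rewrite cinv_dvd // expr0n add0r; congr (_ + _).
apply: eq_bigr => j _; congr (_ ^+ _); rewrite /cinv /bump add1n.
rewrite coprime_sym prime_coprime // dvdn_addr // gtnNdvd //.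
by have := ltn_ord j; lia.
Qed.

Lemma pdvd_sum2 s n (F G : nat -> rat) :
  (forall j, (j < n)%N -> F j - G j \in pdvd p s) ->
  \sum_(j < n) F j - \sum_(j < n) G j \in pdvd p s.
Proof. by move=> h; rewrite -sumrB; apply: rpred_sum => j _; apply: h. Qed.

Lemma pdvd_expl s x y : y \in pint p -> x = p%:R ^+ s * y -> x \in pdvd p s.
Proof. by move=> hy ->; apply: pdvdXp. Qed.

(** Here and in the next three lemmas the coefficients are those of [(1 - t)^(-k)] with [t = p/j],
    up to the sign [(-1)^k]; each witness is the exact remainder. *)
Lemma cinv_rev2 j : (j <= p)%N ->
  c (p - j) ^+ 2 - (c j ^+ 2 + 2 * p%:R * c j ^+ 3) \in pdvd p 2.
Proof.
move=> hj; have E := cinv_rev p_prime (dvdnn p) hj.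
have h1 := pint_cinv p j; have h2 := pint_cinv p (p - j).
move: (c (p - j)) (c j) E h1 h2 => d x E hx hd.
have {}E : d = - x - p%:R * x ^+ 2 + p%:R ^+ 2 * (x ^+ 2 * d).
  by rewrite {1}E {1}E; ring.
pose v := x + p%:R * x ^+ 2; pose z := x ^+ 2 * d.
apply: (@pdvd_expl _ _ (x ^+ 4 - 2%:R * v * z + p%:R ^+ 2 * z ^+ 2)).
  by rewrite /v /z; rpred_tac.
by rewrite {1}E -/z /v; ring.
Qed.

Lemma cinv_rev3 j : (j <= p)%N ->
  c (p - j) ^+ 3 - (- (c j ^+ 3 + 3 * p%:R * c j ^+ 4 + 6 * p%:R ^+ 2 * c j ^+ 5))
    \in pdvd p 3.
Proof.
move=> hj; have E := cinv_rev p_prime (dvdnn p) hj.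
have h1 := pint_cinv p j; have h2 := pint_cinv p (p - j).
move: (c (p - j)) (c j) E h1 h2 => d x E hx hd.
have {}E : d = - (x + p%:R * x ^+ 2 + p%:R ^+ 2 * x ^+ 3) + p%:R ^+ 3 * (x ^+ 3 * d).
  by rewrite {1}E {1}E {1}E; ring.
pose w := x + p%:R * x ^+ 2 + p%:R ^+ 2 * x ^+ 3; pose z := x ^+ 3 * d.
pose t := p%:R * x.
apply: (@pdvd_expl _ _ (- (x ^+ 6 * (7%:R + 6%:R * t + 3%:R * t ^+ 2 + t ^+ 3))
   + (3%:R * w ^+ 2 * z - 3%:R * w * p%:R ^+ 3 * z ^+ 2 + p%:R ^+ 6 * z ^+ 3))).
  by rewrite /t /w /z; rpred_tac.
by rewrite {1}E -/z /w /t; ring.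
Qed.

Lemma cinv_rev4 j : (j <= p)%N ->
  c (p - j) ^+ 4 - (c j ^+ 4 + 4 * p%:R * c j ^+ 5) \in pdvd p 2.
Proof.
move=> hj; have E := cinv_rev p_prime (dvdnn p) hj.
have h1 := pint_cinv p j; have h2 := pint_cinv p (p - j).
move: (c (p - j)) (c j) E h1 h2 => d x E hx hd.
have {}E : d = - x - p%:R * x ^+ 2 + p%:R ^+ 2 * (x ^+ 2 * d).
  by rewrite {1}E {1}E; ring.
pose v := x + p%:R * x ^+ 2; pose z := x ^+ 2 * d; pose t := p%:R * x.
apply: (@pdvd_expl _ _ (x ^+ 6 * (6%:R + 4%:R * t + t ^+ 2) - 4%:R * v ^+ 3 * z
   + 6%:R * v ^+ 2 * p%:R ^+ 2 * z ^+ 2 - 4%:R * v * p%:R ^+ 4 * z ^+ 3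
   + p%:R ^+ 6 * z ^+ 4)).
  by rewrite /t /v /z; rpred_tac.
by rewrite {1}E -/z /v /t; ring.
Qed.

Lemma cinv_rev5 j : (j <= p)%N -> c (p - j) ^+ 5 - (- c j ^+ 5) \in pdvd p 1.
Proof.
move=> hj; have E := cinv_rev p_prime (dvdnn p) hj.
have h1 := pint_cinv p j; have h2 := pint_cinv p (p - j).
move: (c (p - j)) (c j) E h1 h2 => d x E hx hd.
pose z := x * d.
apply: (@pdvd_expl _ _ (5%:R * x ^+ 4 * z - 10%:R * x ^+ 3 * p%:R * z ^+ 2
   + 10%:R * x ^+ 2 * p%:R ^+ 2 * z ^+ 3 - 5%:R * x * p%:R ^+ 3 * z ^+ 4
   + p%:R ^+ 4 * z ^+ 5)).
  by rewrite /z; rpred_tac.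
by rewrite {1}E -/z; ring.
Qed.

Lemma cinv_shift1 j : c (p + j) - (c j - p%:R * c j ^+ 2) \in pdvd p 2.
Proof.
have E := @cinv_shift p p_prime p j (dvdnn p).
have h1 := pint_cinv p j; have h2 := pint_cinv p (p + j).
move: (c (p + j)) (c j) E h1 h2 => d x E hx hd.
apply: (@pdvd_expl _ _ (x ^+ 3 - p%:R * (x ^+ 3 * d))); first by rpred_tac.
by rewrite {1}E; ring.
Qed.

(** The coefficients are those of [(1 + t)^(-2)]. Precision [p^4] is required because the sum of
    these squares gets multiplied by [1/p^2] in [T4_2p]. *)
Lemma cinv_shift2 j : c (p + j) ^+ 2 -
  (c j ^+ 2 - 2 * p%:R * c j ^+ 3 + 3 * p%:R ^+ 2 * c j ^+ 4 - 4 * p%:R ^+ 3 * c j ^+ 5)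
   \in pdvd p 4.
Proof.
have E := @cinv_shift p p_prime p j (dvdnn p).
have h1 := pint_cinv p j; have h2 := pint_cinv p (p + j).
move: (c (p + j)) (c j) E h1 h2 => d x E hx hd.
pose y := x ^+ 5 - p%:R * x ^+ 6 + p%:R ^+ 2 * x ^+ 6 * d.
have {}E : d = x - p%:R * x ^+ 2 + p%:R ^+ 2 * x ^+ 3 - p%:R ^+ 3 * x ^+ 4
    + p%:R ^+ 4 * y.
  by rewrite {1}E {1}E /y; ring.
pose w := x - p%:R * x ^+ 2 + p%:R ^+ 2 * x ^+ 3 - p%:R ^+ 3 * x ^+ 4.
pose t := p%:R * x.
apply: (@pdvd_expl _ _ (x ^+ 6 * (3%:R - 2%:R * t + t ^+ 2)
    + (2%:R * w * y + p%:R ^+ 4 * y ^+ 2))).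
  by rewrite /t /w /y; rpred_tac.
by rewrite {1}E /w /t; ring.
Qed.

Lemma cinv_shift3 j : c (p + j) ^+ 3 -
  (c j ^+ 3 - 3 * p%:R * c j ^+ 4 + 6 * p%:R ^+ 2 * c j ^+ 5) \in pdvd p 3.
Proof.
have E := @cinv_shift p p_prime p j (dvdnn p).
have h1 := pint_cinv p j; have h2 := pint_cinv p (p + j).
move: (c (p + j)) (c j) E h1 h2 => d x E hx hd.
pose w := x - p%:R * x ^+ 2 + p%:R ^+ 2 * x ^+ 3; pose z := - (x ^+ 3 * d).
pose t := p%:R * x.
apply: (@pdvd_expl _ _ (x ^+ 6 * (- 7%:R + 6%:R * t - 3%:R * t ^+ 2 + t ^+ 3)
    + (3%:R * w ^+ 2 * z + 3%:R * w * p%:R ^+ 3 * z ^+ 2 + p%:R ^+ 6 * z ^+ 3))).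
  by rewrite /t /w /z; rpred_tac.
rewrite {1}E /w /t /z; ring.
Qed.

(* Splitting 0 < j < p = 2h + 1 as {i, p - i} and as {2i, p - 2i}, i <= h. *)
Lemma sum_halves (g : nat -> rat) h :
  \sum_(j < h.*2) g j.+1 = \sum_(i < h) (g i.+1 + g (h.*2.+1 - i.+1)%N).
Proof.
rewrite -addnn big_split_ord /= big_split /=; congr (_ + _).
rewrite (reindex_inj rev_ord_inj) /=; apply: eq_bigr => i _; congr g.
by have := ltn_ord i; lia.
Qed.

Lemma sum_parity (g : nat -> rat) h :
  \sum_(j < h.*2) g j.+1 = \sum_(i < h) (g (2 * i.+1)%N + g (h.*2.+1 - 2 * i.+1)%N).
Proof.
have E : \sum_(j < h.*2) g j.+1 = \sum_(i < h) (g (2 * i.+1)%N + g (2 * i).+1).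
  elim: h => [|h IH]; first by rewrite !big_ord0.
  rewrite doubleS !big_ord_recr /= IH -addrA; congr (_ + _).
  rewrite addrC; congr (g _ + g _); lia.
rewrite E !big_split /=; congr (_ + _); rewrite (reindex_inj rev_ord_inj) /=.
by apply: eq_bigr => i _; congr g; have := ltn_ord i; lia.
Qed.

(** Here [dg] acts as the derivative of [g], hence its factor [l / 2]. With [S], [U], [W] as in the
    proof, the two splittings give [S = 2 U - p W] and [S = 2 l U - (l/2) p W] modulo [p^2];
    eliminating [U] gives the claim. *)
Lemma doubling (g dg : nat -> rat) (l : rat) : odd p -> l \in pint p ->
  (forall j, (j <= p)%N -> g (p - j)%N - (g j - p%:R * dg j) \in pdvd p 2) ->
  (forall i, g (2 * i)%N = l * g i) ->
  (forall i, dg (2 * i)%N = l / 2 * dg i) ->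
  (1 - l) * \sum_(j < p./2.*2) g j.+1 - l / 2 * (p%:R * \sum_(i < p./2) dg i.+1)
    \in pdvd p 2.
Proof.
move=> oddp hl hg g2 dg2; set h := p./2.
have pE : p = h.*2.+1 by rewrite -(odd_double_half p) oddp.
set S := \sum_(j < _) _; set W := \sum_(i < h) _.
pose U := \sum_(i < h) g i.+1.
have E1 : S - (2 * U - p%:R * W) \in pdvd p 2.
  rewrite /S sum_halves -pE /U /W !mulr_sumr -sumrB.
  apply: (@pdvd_sum2 2 h (fun i => g i.+1 + g (p - i.+1)%N)
           (fun i => 2 * g i.+1 - p%:R * dg i.+1)) => i hi.
  rewrite (_ : _ - _ = g (p - i.+1)%N - (g i.+1 - p%:R * dg i.+1)); last by ring.
  by apply: hg; lia.
have E2 : S - (2 * l * U - p%:R * (l / 2) * W) \in pdvd p 2.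
  rewrite /S sum_parity -pE /U /W !mulr_sumr -sumrB.
  apply: (@pdvd_sum2 2 h (fun i => g (2 * i.+1)%N + g (p - 2 * i.+1)%N)
           (fun i => 2 * l * g i.+1 - p%:R * (l / 2) * dg i.+1)) => i hi.
  rewrite (_ : _ - _ = g (p - 2 * i.+1)%N - (g (2 * i.+1)%N - p%:R * dg (2 * i.+1)%N)).
    by apply: hg; lia.
  by rewrite g2 dg2; ring.
rewrite (_ : _ - _ = (S - (2 * l * U - p%:R * (l / 2) * W)) - l * (S - (2 * U - p%:R * W))).
  by apply: rpredB => //; apply: (pdvdMl p_gt0).
by field.
Qed.

End HarmonicCongruences.

Lemma pdvd_eq p s x y : x \in pdvd p s -> y = x -> y \in pdvd p s.
Proof. by move=> ? ->. Qed.

(** * H_4 modulo p^2 and the Bernoulli number B_(p-5) *)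

Section BaseCase.
Variable p : nat.
Hypothesis p_prime : prime p.
Hypothesis p_gt5 : (5 < p)%N.
Let p_gt0 : (0 < p)%N := prime_gt0 p_prime.
Notation c := (cinv p).

Let p_odd : odd p.
Proof. by case: (even_prime p_prime) p_gt5 => // ->. Qed.

Let pE : p = p./2.*2.+1.
Proof. by rewrite -{1}(odd_double_half p) p_odd. Qed.

Lemma pint_V d : (0 < d)%N -> (d < p)%N -> d%:R^-1 \in pint p.
Proof. by move=> d0 dp; apply: pint_natV; apply: coprime_ltp. Qed.

Lemma sum_drop0 (g : nat -> rat) : g 0%N = 0 ->
  \sum_(j < p./2.*2) g j.+1 = \sum_(j < p) g j.
Proof.
move=> g0; have -> : \sum_(j < p) g j = \sum_(j < p./2.*2.+1) g j.
  by rewrite -pE.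
by rewrite big_ord_recl /= g0 add0r.
Qed.

Lemma cinv0 : c 0 = 0.
Proof. by apply: cinv_dvd. Qed.

Lemma cinv_half i : c (2 * i) = c i / 2.
Proof.
have p2 : (2 < p)%N by apply: leq_trans p_gt5.
by rewrite -(cinv_double i p2 p_prime); field.
Qed.

(** [doubling] for [j^(-2)], where [l = 1/4], makes [3 H_2] a [p]-integral multiple of [p] modulo
    [p^2], and 3 is a unit. *)
Lemma hsum2_pdvd : hsum p 2 \in pdvd p 1.
Proof.
have h4 : 4%:R^-1 \in pint p by apply: pint_V => //; apply: leq_trans p_gt5.
have h2 : 2%:R^-1 \in pint p by apply: pint_V => //; apply: leq_trans p_gt5.
pose g j := c j ^+ 2; pose dg j := - 2%:R * c j ^+ 3.
have D1 j : (j <= p)%N -> g (p - j)%N - (g j - p%:R * dg j) \in pdvd p 2.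
  by move=> hj; apply: pdvd_eq (cinv_rev2 p_prime hj) _; rewrite /g /dg; ring.
have D2 i : g (2 * i)%N = 4%:R^-1 * g i by rewrite /g cinv_half; field.
have D3 i : dg (2 * i)%N = 4%:R^-1 / 2 * dg i by rewrite /dg cinv_half; field.
have := doubling p_prime p_odd h4 D1 D2 D3.
rewrite (@sum_drop0 g) /g /dg ?cinv0 ?expr0n // -hsum_cinv //.
set W := \sum_(i < _) _ => E.
have hW : W \in pint p.
  by apply: rpred_sum => i _; rpred_tac; apply: pint_cinv.
apply: (@pdvd_unit _ p_gt0 _ 3) => //; first by apply: coprime_ltp => //; apply: leq_trans p_gt5.
rewrite (_ : _ * _ = 4%:R * ((1 - 4%:R^-1) * hsum p 2 - 4%:R^-1 / 2 * (p%:R * W))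
   + p%:R * (2%:R^-1 * W)); last by field.
apply: rpredD; last by rewrite -[p%:R]expr1; apply: pdvdXp => //; apply: rpredM.
by apply: (pdvdMl p_gt0 (rpred_nat _ _)); apply: pdvd_leq E.
Qed.

Lemma fermat_pdvd a : coprime a p -> a%:R ^+ p.-1 - 1 \in pdvd p 1.
Proof.
move=> ca; have a0 : (0 < a)%N by case: a ca => //; rewrite coprime0p.
have aX0 : (0 < a ^ p.-1)%N by rewrite expn_gt0 a0.
rewrite -natrX -(natrB _ aX0); apply: pdvd1_nat => //.
have /eqP := fermat_little a p_prime; rewrite eqn_mod_dvd; last first.
  by rewrite -{1}[a]expn1 leq_pexp2l.
have -> : (a ^ p - a = a * (a ^ p.-1 - 1))%N by rewrite mulnBr muln1 -expnS prednK.
rewrite Gauss_dvdr //.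
by rewrite coprime_sym.
Qed.

Lemma expr_addM2 (x y : rat) n : x \in pint p -> y \in pint p ->
  exists2 z, z \in pint p & (x + y) ^+ n.+1 = x ^+ n.+1 + n.+1%:R * x ^+ n * y + y ^+ 2 * z.
Proof.
move=> hx hy; elim: n => [|n [z hz E]]; first by exists 0; rewrite ?rpred0 //; ring.
exists (n.+1%:R * x ^+ n + (x + y) * z); first by rpred_tac.
by rewrite exprS E -[n.+2%:R]natr1 !exprS; ring.
Qed.

Lemma hsum4_half :
  15%:R * hsum p 4 + 2%:R * (p%:R * \sum_(i < p./2) c i.+1 ^+ 5) \in pdvd p 2.
Proof.
have h16 : 16%:R^-1 \in pint p.
  have -> : 16%:R^-1 = 2%:R^-1 ^+ 4 :> rat by field.
  by apply: rpredX; apply: pint_V => //; apply: leq_trans p_gt5.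
pose g j := c j ^+ 4; pose dg j := - 4%:R * c j ^+ 5.
have D1 j : (j <= p)%N -> g (p - j)%N - (g j - p%:R * dg j) \in pdvd p 2.
  by move=> hj; apply: pdvd_eq (cinv_rev4 p_prime hj) _; rewrite /g /dg; ring.
have D2 i : g (2 * i)%N = 16%:R^-1 * g i by rewrite /g cinv_half; field.
have D3 i : dg (2 * i)%N = 16%:R^-1 / 2 * dg i by rewrite /dg cinv_half; field.
have {D1 D2 D3} := doubling p_prime p_odd h16 D1 D2 D3.
rewrite (@sum_drop0 g) /g /dg ?cinv0 ?expr0n // -hsum_cinv // -mulr_sumr => E.
by apply: pdvd_eq (pdvdMl p_gt0 (rpred_nat _ 16) E) _; field.
Qed.

(** [doubling] for [j^(q+2)]; the exponent is even, so [(p - j)^(q+2) = (j - p)^(q+2)] expands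
    without a sign. It is used with [q + 2 = p - 5]. *)
Lemma power_sum_half q : odd q = false ->
  (1 - 2%:R ^+ q.+2) * \sum_(j < p) j%:R ^+ q.+2 - 2%:R ^+ q.+2 / 2 *
    (p%:R * (q.+2%:R * \sum_(i < p./2) i.+1%:R ^+ q.+1)) \in pdvd p 2.
Proof.
move=> oq; pose g j : rat := j%:R ^+ q.+2; pose dg j : rat := q.+2%:R * j%:R ^+ q.+1.
have D0 : 2%:R ^+ q.+2 \in pint p by rewrite rpredX // rpred_nat.
have D1 j : (j <= p)%N -> g (p - j)%N - (g j - p%:R * dg j) \in pdvd p 2.
  move=> hj; have hp : - p%:R \in pint p by rewrite rpredN rpred_nat.
  rewrite /g /dg natrB // -[p%:R - j%:R]opprB exprNn -signr_odd /= oq expr0 mul1r.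
  have [z hz ->] := @expr_addM2 j%:R (- p%:R) q.+1 (rpred_nat _ _) hp.
  by apply: (pdvd_expl p_prime hz); ring.
have D2 i : g (2 * i)%N = 2%:R ^+ q.+2 * g i by rewrite /g natrM exprMn.
have D3 i : dg (2 * i)%N = 2%:R ^+ q.+2 / 2 * dg i.
  by rewrite /dg natrM exprMn [in RHS]exprS; field.
have {D0 D1 D2 D3} := doubling p_prime p_odd D0 D1 D2 D3.
by rewrite (@sum_drop0 g) /g /dg ?expr0n // -mulr_sumr.
Qed.

(** Since [q + 1 = (p - 1) - 5], Fermat's little theorem gives [i^(q+1) = i^(-5)] modulo [p]. *)
Lemma half_sums_congr q : (q.+2 + 5 = p)%N ->
  \sum_(i < p./2) i.+1%:R ^+ q.+1 - \sum_(i < p./2) c i.+1 ^+ 5 \in pdvd p 1.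
Proof.
move=> pq; have pq1 : p.-1 = (q.+1 + 5)%N by rewrite -pq.
apply: (@pdvd_sum2 p 1 p./2 (fun i => i.+1%:R ^+ q.+1) (fun i => c i.+1 ^+ 5)) => i hi.
have ip : (i.+1 < p)%N by rewrite pE -muln2; lia.
have ci : coprime i.+1 p by apply: coprime_ltp.
apply: pdvd_eq (pdvdMl p_gt0 (rpredX 5 (pint_natV ci)) (fermat_pdvd ci)) _.
by rewrite cinv_ltp // pq1 exprD; field; rewrite addrC natr1 pnatr_eq0.
Qed.

Lemma hsum4_bernoulli :
  5 * hsum p 4 - 4 * (p%:R * bernoulli (p - 5)) \in pdvd p 2.
Proof.
have [q pq] : exists q, (q.+2 + 5 = p)%N.
  have p6 : p != 6 by apply: contraTneq p_prime => ->.
  by exists (p - 7)%N; move: p_gt5 p6; lia.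
have oq : odd q = false by move: p_odd; rewrite -pq; lia.
have qp : (q.+3 < p)%N by rewrite -pq; lia.
have -> : (p - 5 = q.+2)%N by rewrite -pq addnK.
have c2 : coprime 2 p by apply: coprime_ltp => //; apply: leq_trans p_gt5.
have c15 : coprime 15 p.
  by rewrite (_ : 15 = 3 * 5)%N // coprimeMl !coprime_ltp //; apply: leq_trans p_gt5.
have qE : q.+2%:R = p%:R - 5%:R :> rat by rewrite -pq natrD addrK.
have hB := @pint_bernoulli p p_prime q.+2 qp.
have hW : \sum_(i < p./2) c i.+1 ^+ 5 \in pint p.
  by apply: rpred_sum => i _; apply: rpredX; apply: pint_cinv.
(* As [q + 2 = p - 5], the left term is [2^(p-1)]; this makes the doubling factors of [j^(-4)] and
   of [j^(p-5)] agree modulo [p]. *)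
have F : 16%:R * 2%:R ^+ q.+2 - 1 \in pdvd p 1.
  have pq1 : p.-1 = (q.+2 + 4)%N by rewrite -pq; lia.
  by apply: pdvd_eq (fermat_pdvd c2) _; rewrite pq1 exprD; ring.
move: hsum4_half (power_sum_half oq) (half_sums_congr pq) F hB hW
  (@power_sum_bernoulli p p_prime q.+2 isT qp).
set W := \sum_(i < p./2) c i.+1 ^+ 5; set W' := \sum_(i < p./2) _.
set S := \sum_(j < p) _; set L := 2%:R ^+ q.+2; set B := bernoulli q.+2.
rewrite qE => /(pdvdP p_gt0)[x1 hx1 X1] /(pdvdP p_gt0)[x2 hx2 X2].
move=> /(pdvdP p_gt0)[w hw X5] /(pdvdP p_gt0)[m hm X4] hB hW /(pdvdP p_gt0)[s hs X3].
(* [K] is the quotient by [p^2] in [30 p B + 5 p W = 0] modulo [p^2], which is 32 times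
   [power_sum_half] after replacing [S] by [p B], [L] by [1/16] and [W'] by [W]. *)
pose K := W + (p%:R - 5%:R) * w + m * (p%:R - 5%:R) * (W + p%:R * w)
   + 32%:R * x2 - 30%:R * s + 2%:R * m * (B + p%:R * s).
have hK : K \in pint p by rewrite /K; rpred_tac.
have EK : 30%:R * p%:R * B + 5%:R * p%:R * W = p%:R ^+ 2 * K.
  rewrite expr1 in X4; rewrite expr1 in X5.
  have SE : S = p%:R * B + p%:R ^+ 2 * s by rewrite -X3; ring.
  have LE : L = (1 + p%:R * m) / 16%:R by rewrite -X4; field.
  have WE : W' = W + p%:R * w by rewrite -X5; ring.
  move: X2; rewrite SE LE WE => /eqP; rewrite -subr_eq0 => /eqP X2.
  (* Adding [32 * 0] and rewriting 0 by the relation [X2] turns the goal into a field identity. *)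
  have E0 : p%:R ^+ 2 * K = p%:R ^+ 2 * K + 32%:R * 0 by rewrite mulr0 addr0.
  by rewrite E0 -X2 /K; field.
have hx : 5%:R * x1 - 2%:R * K \in pint p by rpred_tac.
(* [15 (5 H_4 - 4 p B) = 5 (15 H_4 + 2 p W) - 2 (30 p B + 5 p W)]. *)
apply: (pdvd_unit p_gt0 c15 isT); apply: (pdvd_expl p_prime hx).
have -> : p%:R ^+ 2 * (5%:R * x1 - 2%:R * K) =
  5%:R * (p%:R ^+ 2 * x1) - 2%:R * (p%:R ^+ 2 * K) by ring.
by rewrite -X1 -EK; ring.
Qed.

End BaseCase.

(** * The case r = 1 *)

Section BaseValues.
Variable p : nat.
Hypothesis p_prime : prime p.
Hypothesis p_gt5 : (5 < p)%N.
Let p_gt0 : (0 < p)%N := prime_gt0 p_prime.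
Notation c := (cinv p).
Notation H := (hsum p).

Lemma pint_half : 2%:R^-1 \in pint p.
Proof. by apply: pint_V => //; apply: leq_trans p_gt5. Qed.

Lemma pdvd_halve s x : x + x \in pdvd p s -> x \in pdvd p s.
Proof.
by move=> h; apply: pdvd_eq (pdvdMl p_gt0 pint_half h) _; field.
Qed.

(** Wolstenholme's congruence: pairing [j] with [p - j] gives [2 H_1 = -p H_2] modulo [p^2], and [p]
    divides [H_2]. *)
Lemma hsum1_pdvd : H 1 \in pdvd p 2.
Proof.
apply: pdvd_halve.
have E : H 1 - \sum_(j < p) (- (c j ^+ 1 + p%:R * c j ^+ 2)) \in pdvd p 2.
  rewrite [H 1]hsum_cinv_rev //.
  apply: (@pdvd_sum2 p 2 p (fun j => c (p - j) ^+ 1)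
           (fun j => - (c j ^+ 1 + p%:R * c j ^+ 2))) => j hj.
  have E := cinv_rev p_prime (dvdnn p) (ltnW hj).
  apply: (@pdvd_expl p p_prime 2 _ (c j ^+ 2 * c (p - j))).
    by rpred_tac; apply: pint_cinv.
  by rewrite {1}E {1}E; ring.
move: E; rewrite sumrN big_split /= -mulr_sumr -!hsum_cinv // => E.
have E2 : p%:R * H 2 \in pdvd p 2.
  have := pdvdM p_gt0 (pdvd1_nat p_gt0 (dvdnn p)) (hsum2_pdvd p_prime p_gt5).
  by rewrite addn1.
by apply: pdvd_eq (rpredB E E2) _; ring.
Qed.

Lemma hsum5_pdvd : H 5 \in pdvd p 1.
Proof.
apply: pdvd_halve.
have E : H 5 - \sum_(j < p) (- c j ^+ 5) \in pdvd p 1.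
  rewrite [H 5]hsum_cinv_rev //.
  apply: (@pdvd_sum2 p 1 p (fun j => c (p - j) ^+ 5) (fun j => - c j ^+ 5)) => j hj.
  exact: (cinv_rev5 p_prime (ltnW hj)).
by move: E; rewrite sumrN -hsum_cinv // opprK.
Qed.

Lemma hsum3_rel : 2%:R * H 3 + 3%:R * p%:R * H 4 + 6%:R * p%:R ^+ 2 * H 5 \in pdvd p 3.
Proof.
have E : H 3 - \sum_(j < p)
   (- (c j ^+ 3 + 3 * p%:R * c j ^+ 4 + 6 * p%:R ^+ 2 * c j ^+ 5)) \in pdvd p 3.
  rewrite [H 3]hsum_cinv_rev //.
  apply: (@pdvd_sum2 p 3 p (fun j => c (p - j) ^+ 3)
    (fun j => - (c j ^+ 3 + 3 * p%:R * c j ^+ 4 + 6 * p%:R ^+ 2 * c j ^+ 5))) => j hj.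
  exact: (cinv_rev3 p_prime (ltnW hj)).
move: E; rewrite sumrN !big_split /= -!mulr_sumr -!hsum_cinv // => E.
by apply: pdvd_eq E _; ring.
Qed.

Lemma shifted1 : \sum_(j < p) c (p + j) ^+ 1 - (H 1 - p%:R * H 2) \in pdvd p 2.
Proof.
have E := @pdvd_sum2 p 2 p (fun j => c (p + j)) (fun j => c j - p%:R * c j ^+ 2)
  (fun j _ => cinv_shift1 p_prime j).
move: E; rewrite sumrB -mulr_sumr -hsum_cinv // => E.
by apply: pdvd_eq E _; rewrite (hsum_cinv p_prime 1).
Qed.

Lemma shifted2 : \sum_(j < p) c (p + j) ^+ 2 -
  (H 2 - 2%:R * p%:R * H 3 + 3%:R * p%:R ^+ 2 * H 4 - 4%:R * p%:R ^+ 3 * H 5) \in pdvd p 4.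
Proof.
have E := @pdvd_sum2 p 4 p (fun j => c (p + j) ^+ 2)
  (fun j => c j ^+ 2 - 2 * p%:R * c j ^+ 3 + 3 * p%:R ^+ 2 * c j ^+ 4 - 4 * p%:R ^+ 3 * c j ^+ 5)
  (fun j _ => cinv_shift2 p_prime j).
by move: E; rewrite !(sumrB, big_split) /= -!mulr_sumr -!hsum_cinv.
Qed.

Lemma shifted3 : \sum_(j < p) c (p + j) ^+ 3 -
  (H 3 - 3%:R * p%:R * H 4 + 6%:R * p%:R ^+ 2 * H 5) \in pdvd p 3.
Proof.
have E := @pdvd_sum2 p 3 p (fun j => c (p + j) ^+ 3)
  (fun j => c j ^+ 3 - 3 * p%:R * c j ^+ 4 + 6 * p%:R ^+ 2 * c j ^+ 5)
  (fun j _ => cinv_shift3 p_prime j).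
by move: E; rewrite !(sumrB, big_split) /= -!mulr_sumr -!hsum_cinv.
Qed.

Lemma hsum4_pdvd : H 4 \in pdvd p 1.
Proof.
have c5 : coprime 5 p by apply: coprime_ltp.
apply: (pdvd_unit p_gt0 c5 isT).
have hB : bernoulli (p - 5) \in pint p by apply: pint_bernoulli => //; move: p_gt5; lia.
have E := @pdvd_leq p p_gt0 1 2 _ isT (hsum4_bernoulli p_prime p_gt5).
have E2 : 4 * (p%:R * bernoulli (p - 5)) \in pdvd p 1.
  apply: (pdvdMl p_gt0 (rpred_nat _ _)); apply: (pdvdMr p_gt0) => //.
  exact: pdvd1_nat.
by apply: pdvd_eq (rpredD E E2) _; ring.
Qed.

Lemma T4_base_hsum : T4 p p + 12%:R * H 4 \in pdvd p 2 /\
  T4 p (2 * p) + 60%:R * H 4 \in pdvd p 2.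
Proof.
have p0 := natp_neq0 p_gt0; have h2 := pint_half.
rewrite T4_2p // !hsum_2p //.
have -> : T4 p p = 4 / p%:R * (H 1 ^+ 3 - 3 * H 1 * H 2 + 2 * H 3).
  by apply: (mulfI p0); rewrite T4_p //; field.
move: shifted1 shifted2 shifted3.
move: hsum1_pdvd (hsum2_pdvd p_prime p_gt5) hsum3_rel hsum4_pdvd hsum5_pdvd.
move: (H 1) (H 2) (H 3) (H 4) (H 5) (\sum_(j < p) c (p + j) ^+ 1)
  (\sum_(j < p) c (p + j) ^+ 2) (\sum_(j < p) c (p + j) ^+ 3).
move=> H1 H2 H3 H4 H5 G1 G2 G3.
move=> /(pdvdP p_gt0)[u1 hu1 E1] /(pdvdP p_gt0)[u2 hu2 E2] /(pdvdP p_gt0)[x3 hx3 E3].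
move=> /(pdvdP p_gt0)[u4 hu4 E4] /(pdvdP p_gt0)[u5 hu5 E5].
move=> /(pdvdP p_gt0)[y1 hy1 F1] /(pdvdP p_gt0)[y2 hy2 F2] /(pdvdP p_gt0)[y3 hy3 F3].
rewrite expr1 in E2; rewrite expr1 in E4; rewrite expr1 in E5.
(* With [H3 = p^2 u3] and [H4 = p u4], relation [hsum3_rel] becomes [2 u3 + 3 u4 = p v]. *)
pose v := - 6%:R * u5 + x3.
have hv : v \in pint p by rewrite /v; rpred_tac.
have E3' : H3 = p%:R ^+ 2 * ((- 3%:R * u4 + p%:R * v) * 2%:R^-1).
  have -> : H3 = ((2%:R * H3 + 3%:R * p%:R * H4 + 6%:R * p%:R ^+ 2 * H5)
     - 3%:R * p%:R * H4 - 6%:R * p%:R ^+ 2 * H5) / 2%:R by field.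
  by rewrite E3 E4 E5 /v; field.
pose u3 := (- 3%:R * u4 + p%:R * v) * 2%:R^-1.
have hu3 : u3 \in pint p by rewrite /u3; rpred_tac.
have G1E : G1 = p%:R ^+ 2 * (u1 - u2 + y1).
  have -> : G1 = (G1 - (H1 - p%:R * H2)) + (H1 - p%:R * H2) by ring.
  by rewrite F1 E1 E2; ring.
have G2E : G2 = p%:R * u2 - 2%:R * p%:R ^+ 3 * u3 + 3%:R * p%:R ^+ 3 * u4
     + p%:R ^+ 4 * (y2 - 4%:R * u5).
  have -> : G2 = (G2 - (H2 - 2%:R * p%:R * H3 + 3%:R * p%:R ^+ 2 * H4 - 4%:R * p%:R ^+ 3 * H5))
    + (H2 - 2%:R * p%:R * H3 + 3%:R * p%:R ^+ 2 * H4 - 4%:R * p%:R ^+ 3 * H5) by ring.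
  by rewrite F2 E2 E3' E4 E5 /u3; ring.
have G3E : G3 = p%:R ^+ 2 * u3 - 3%:R * p%:R ^+ 2 * u4 + p%:R ^+ 3 * (6%:R * u5 + y3).
  have -> : G3 = (G3 - (H3 - 3%:R * p%:R * H4 + 6%:R * p%:R ^+ 2 * H5))
    + (H3 - 3%:R * p%:R * H4 + 6%:R * p%:R ^+ 2 * H5) by ring.
  by rewrite F3 E3' E4 E5 /u3; ring.
move: E3'; rewrite -/u3 => E3'.
have v3 : 2%:R * u3 + 3%:R * u4 = p%:R * v by rewrite /u3; field.
clear F1 F2 F3 E3.
split.
  have hz : 4%:R * v + 4%:R * (p%:R ^+ 3 * u1 ^+ 3 - 3%:R * u1 * u2) \in pint p.
    by rpred_tac.
  apply: (pdvd_expl p_prime hz); rewrite E1 E2 E3' E4.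
  have -> : u3 = (p%:R * v - 3%:R * u4) / 2%:R by rewrite -v3; field.
  by field.
(* The harmonic sums up to [2p] of orders 1 and 2 are [p^2 a + 1/p] and [p b + 1/p^2]. In the cubic
   expression the [1/p^3] terms cancel as [1 - 3 + 2 = 0], and so do the terms [3 a]; the part
   [2 u2] of [b] cancels against the last term of [T4_2p]. *)
pose a := u1 + (u1 - u2 + y1).
pose b := 2%:R * u2 - 2%:R * p%:R ^+ 2 * u3 + 3%:R * p%:R ^+ 2 * u4
   + p%:R ^+ 3 * (y2 - 4%:R * u5).
have ha : a \in pint p by rewrite /a; rpred_tac.
have hb : b \in pint p by rewrite /b; rpred_tac.
have hz : 10%:R * v + 2%:R * p%:R ^+ 3 * a ^+ 3 - 6%:R * (a * b)
    + 4%:R * (6%:R * u5 + y3) - 6%:R * (y2 - 4%:R * u5)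
    + 6%:R * a ^+ 2 - 12%:R * u1 ^+ 2 \in pint p.
  by rpred_tac.
apply: (pdvd_expl p_prime hz); rewrite G1E G2E G3E E1 E2 E3' E4 /a /b.
have -> : v = (2%:R * u3 + 3%:R * u4) / p%:R by rewrite v3; field.
by field.
Qed.

Lemma T4_base_ge7 : T4 p p + 48%:R * (p%:R / 5%:R * bernoulli (p - 5)) \in pdvd p 2 /\
  T4 p (2 * p) + 240%:R * (p%:R / 5%:R * bernoulli (p - 5)) \in pdvd p 2.
Proof.
have [E1 E2] := T4_base_hsum; have E4 := hsum4_bernoulli p_prime p_gt5.
have h5 : 5%:R^-1 \in pint p by apply: pint_natV; apply: coprime_ltp.
have {}E4 := pdvdMl p_gt0 h5 E4.
split.
  by apply: pdvd_eq (rpredB E1 (pdvdMl p_gt0 (rpred_nat _ 12) E4)) _; field.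
by apply: pdvd_eq (rpredB E2 (pdvdMl p_gt0 (rpred_nat _ 60) E4)) _; field.
Qed.

End BaseValues.

(** * The prime 5 *)

Definition tab4 (a b c d : rat) (i : nat) : rat := nth 0 [:: 0; a; b; c; d] i.

(** The shape of [invpoly 5 5 k]; products of two such are of the shape [octic], so the coefficients
    at 5, 10, 15 of fourfold products reduce to explicit formulas. *)
Definition quartic a b c d : {poly rat} := \poly_(i < 5) tab4 a b c d i.

Definition octic a2 a3 a4 a5 a6 a7 a8 : {poly rat} :=
  \poly_(i < 9) nth 0 [:: 0; 0; a2; a3; a4; a5; a6; a7; a8] i.

Lemma quarticE a b c d : quartic a b c d =
  a%:P * 'X + b%:P * 'X^2 + c%:P * 'X^3 + d%:P * 'X^4.
Proof.
rewrite /quartic poly_def !big_ord_recr big_ord0 /= /tab4 /= -!mul_polyC.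
by rewrite mul0r; ring.
Qed.

Lemma octicE a2 a3 a4 a5 a6 a7 a8 : octic a2 a3 a4 a5 a6 a7 a8 =
  a2%:P * 'X^2 + a3%:P * 'X^3 + a4%:P * 'X^4 + a5%:P * 'X^5 + a6%:P * 'X^6
  + a7%:P * 'X^7 + a8%:P * 'X^8.
Proof.
rewrite /octic poly_def !big_ord_recr big_ord0 /= -!mul_polyC.
by rewrite !mul0r; ring.
Qed.

Lemma quarticM a b c d a' b' c' d' :
  quartic a b c d * quartic a' b' c' d' =
  octic (a * a') (a * b' + b * a') (a * c' + b * b' + c * a')
    (a * d' + b * c' + c * b' + d * a') (b * d' + c * c' + d * b')
    (c * d' + d * c') (d * d').
Proof. by rewrite !quarticE octicE !rmorphD !rmorphM /=; ring. Qed.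

Section OcticProduct.
Variables a2 a3 a4 a5 a6 a7 a8 b2 b3 b4 b5 b6 b7 b8 : rat.
Let u := octic a2 a3 a4 a5 a6 a7 a8.
Let v := octic b2 b3 b4 b5 b6 b7 b8.

Lemma coef5_octicM : (u * v)`_5 = a2 * b3 + a3 * b2.
Proof. by rewrite coefM !big_ord_recr big_ord0 /= !coef_poly /=; ring. Qed.

Lemma coef10_octicM : (u * v)`_10 =
  a2 * b8 + a3 * b7 + a4 * b6 + a5 * b5 + a6 * b4 + a7 * b3 + a8 * b2.
Proof. by rewrite coefM !big_ord_recr big_ord0 /= !coef_poly /=; ring. Qed.

Lemma coef15_octicM : (u * v)`_15 = a7 * b8 + a8 * b7.
Proof. by rewrite coefM !big_ord_recr big_ord0 /= !coef_poly /=; ring. Qed.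

End OcticProduct.

Lemma invpoly5 k : invpoly 5 5 k.+1 =
  quartic 1 (2%:R^-1 ^+ k.+1) (3%:R^-1 ^+ k.+1) (4%:R^-1 ^+ k.+1).
Proof.
apply/polyP => i; rewrite !coef_poly; case: i => [|[|[|[|[|i]]]]] //=.
  by rewrite /cinv /= expr0n.
by rewrite /cinv /= invr1 expr1n.
Qed.

Ltac tab_tac := rewrite -mulrA !quarticM ?mul1n ?coef5_octicM ?coef10_octicM ?coef15_octicM.

Lemma expr4E (u : {poly rat}) : u ^+ 4 = u * u * u * u.
Proof. by ring. Qed.

Lemma expr3ME (u v : {poly rat}) : u ^+ 3 * v = u * u * u * v.
Proof. by ring. Qed.

Lemma T4_5 : T4 5 5 = 2%:R.
Proof.
rewrite T4_Q // expr4E invpoly5.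
by tab_tac; field.
Qed.

Lemma T4_10 : T4 5 10 + 240%:R \in pdvd 5 2.
Proof.
have [z hz] := @T4_2Q 5 5 isT isT isT.
have -> : (invpoly 5 5 1 ^+ 4)`_(2 * 5) = 49%:R / 27%:R.
  by rewrite expr4E invpoly5; tab_tac; field.
have -> : (invpoly 5 5 1 ^+ 4)`_(1 * 5) = 2%:R.
  by rewrite expr4E invpoly5; tab_tac; field.
have -> : (invpoly 5 5 1 ^+ 3 * invpoly 5 5 2)`_(1 * 5) = 7%:R / 4%:R.
  by rewrite expr3ME !invpoly5; tab_tac; field.
move=> ->; have h27 : 27%:R^-1 \in pint 5 by apply: pint_natV.
(* [49/27 + 4 * 2 - 4 * 5 * (7/4) + 240 = 25 * 232/27]. *)
have hy : 232%:R * 27%:R^-1 + z \in pint 5 by rpred_tac.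
by apply: (@pdvd_expl 5 isT 2 _ _ hy); field.
Qed.

Lemma pdvd_mul4 (x y z t x' y' z' t' : rat) p : prime p ->
  [/\ x \in pint p, y \in pint p, z \in pint p & t \in pint p] ->
  [/\ x' \in pint p, y' \in pint p, z' \in pint p & t' \in pint p] ->
  [/\ x - x' \in pdvd p 1, y - y' \in pdvd p 1, z - z' \in pdvd p 1 & t - t' \in pdvd p 1] ->
  x * y * z * t - x' * y' * z' * t' \in pdvd p 1.
Proof.
move=> /prime_gt0 p0 [hx hy hz ht] [hx' hy' hz' ht'] [dx dy dz dt].
have -> : x * y * z * t - x' * y' * z' * t' =
  y * z * t * (x - x') + x' * z * t * (y - y') + x' * y' * t * (z - z')
   + x' * y' * z' * (t - t') by ring.
by do 3?(apply: rpredD); apply: (pdvdMl p0) => //; rpred_tac.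
Qed.

Lemma coefM4_congr p (f g h k f' g' h' k' : nat -> rat) n N : prime p ->
  (forall i, [/\ f i \in pint p, g i \in pint p, h i \in pint p & k i \in pint p]) ->
  (forall i, [/\ f' i \in pint p, g' i \in pint p, h' i \in pint p & k' i \in pint p]) ->
  (forall i, [/\ f i - f' i \in pdvd p 1, g i - g' i \in pdvd p 1,
       h i - h' i \in pdvd p 1 & k i - k' i \in pdvd p 1]) ->
  (\poly_(i < n) f i * \poly_(i < n) g i * \poly_(i < n) h i * \poly_(i < n) k i)`_N
  - (\poly_(i < n) f' i * \poly_(i < n) g' i * \poly_(i < n) h' i * \poly_(i < n) k' i)`_N
    \in pdvd p 1.
Proof.
move=> pr P P' D; rewrite !coefM4_poly.
rewrite -sumrB; apply: rpred_sum => i1 _; rewrite -sumrB; apply: rpred_sum => i2 _.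
rewrite -sumrB; apply: rpred_sum => i3 _; rewrite -sumrB; apply: rpred_sum => i4 _.
have [? _ _ _] := P i1; have [_ ? _ _] := P i2; have [_ _ ? _] := P i3.
have [_ _ _ ?] := P i4; have [? _ _ _] := P' i1; have [_ ? _ _] := P' i2.
have [_ _ ? _] := P' i3; have [_ _ _ ?] := P' i4; have [? _ _ _] := D i1.
have [_ ? _ _] := D i2; have [_ _ ? _] := D i3; have [_ _ _ ?] := D i4.
by apply: pdvd_mul4.
Qed.

Definition inv5 (k i : nat) : rat :=
  tab4 1 (2%:R^-1 ^+ k) (3%:R^-1 ^+ k) (4%:R^-1 ^+ k) i.

(** Small integers congruent modulo 5 to [1], [2^(-k)], [3^(-k)], [4^(-k)]; the last branch is meant
    for [k = 3]. *)
Definition res5 (k : nat) : nat -> rat :=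
  match k with
  | 1 => tab4 1 (- 2%:R) 2%:R (- 1)
  | 2 => tab4 1 (- 1) (- 1) 1
  | _ => tab4 1 2%:R (- 2%:R) (- 1)
  end.

Lemma pint_inv5 k i : inv5 k i \in pint 5.
Proof.
case: i => [|[|[|[|[|i]]]]]; rewrite /inv5 /tab4 /= ?nth_nil ?rpred0 ?rpred1 //;
  by apply: rpredX; apply: pint_natV.
Qed.

Lemma pint_res5 k i : res5 k i \in pint 5.
Proof.
case: k => [|[|[|k]]]; case: i => [|[|[|[|[|i]]]]];
  by rewrite /res5 /tab4 /= ?nth_nil ?rpredN ?rpred0 ?rpred1 ?rpred_nat.
Qed.

Lemma inv5_res5 k i : (0 < k <= 3)%N -> inv5 k i - res5 k i \in pdvd 5 1.
Proof.
(* [(n - m)/d] is the quotient of the difference by 5; [m] serves for negative numerators. *)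
have V d n m : coprime d 5 -> n%:R / d%:R - m%:R / d%:R \in pint 5.
  by move=> cd; apply: rpredB; apply: rpredM; rewrite ?rpred_nat ?pint_natV.
have I (x y : rat) : y \in pint 5 -> x = 5%:R * y -> x \in pdvd 5 1.
  by move=> hy ->; apply: (@pdvd_expl 5 isT 1 _ y) => //; rewrite expr1.
case: k => [|[|[|[|k]]]] // _; case: i => [|[|[|[|[|i]]]]];
  rewrite /inv5 /res5 /tab4 /= ?nth_nil ?subrr ?rpred0 //.
- by apply: (I _ _ (V 2%N 1%N 0%N isT)); field.
- by apply: (I _ _ (V 3%N 0%N 1%N isT)); field.
- by apply: (I _ _ (V 4%N 1%N 0%N isT)); field.
- by apply: (I _ _ (V 4%N 1%N 0%N isT)); field.
- by apply: (I _ _ (V 9%N 2%N 0%N isT)); field.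
- by apply: (I _ _ (V 16%N 0%N 3%N isT)); field.
- by apply: (I _ _ (V 8%N 0%N 3%N isT)); field.
- by apply: (I _ _ (V 27%N 11%N 0%N isT)); field.
- by apply: (I _ _ (V 64%N 13%N 0%N isT)); field.
Qed.

Lemma coef_res5 a b c d N : (0 < a <= 3)%N -> (0 < b <= 3)%N -> (0 < c <= 3)%N ->
  (0 < d <= 3)%N ->
  (invpoly 5 5 a * invpoly 5 5 b * invpoly 5 5 c * invpoly 5 5 d)`_N
  - (\poly_(i < 5) res5 a i * \poly_(i < 5) res5 b i * \poly_(i < 5) res5 c i
       * \poly_(i < 5) res5 d i)`_N \in pdvd 5 1.
Proof.
case: a b c d => [|a] [|b] [|c] [|d] // ha hb hc hd; rewrite !invpoly5 /quartic.
by apply: coefM4_congr => // i; split;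
  do ?[exact: pint_inv5 | exact: pint_res5 | exact: inv5_res5].
Qed.

(** Not all the binomial coefficients are divisible by 5 here, so the coefficients at 5, 10, 15 are
    computed modulo 5 from [res5]. *)
Lemma second_order_5 n : n = 5%N \/ n = 10%N -> second_order 5 5 n \in pdvd 5 1.
Proof.
move=> hn; rewrite /second_order.
have cE s : (invpoly 5 5 1 ^+ 3 * invpoly 5 5 3)`_(s * 5) =
   (invpoly 5 5 1 * invpoly 5 5 1 * invpoly 5 5 1 * invpoly 5 5 3)`_(s * 5).
  by rewrite expr3ME.
have dE s : (invpoly 5 5 1 ^+ 2 * invpoly 5 5 2 ^+ 2)`_(s * 5) =
   (invpoly 5 5 1 * invpoly 5 5 1 * invpoly 5 5 2 * invpoly 5 5 2)`_(s * 5).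
  by rewrite !expr2 mulrA.
rewrite !cE !dE {cE dE}.
have C s v : (quartic 1 (- 2%:R) 2%:R (- 1) * quartic 1 (- 2%:R) 2%:R (- 1)
       * quartic 1 (- 2%:R) 2%:R (- 1) * quartic 1 2%:R (- 2%:R) (- 1))`_(s * 5) = v ->
  (invpoly 5 5 1 * invpoly 5 5 1 * invpoly 5 5 1 * invpoly 5 5 3)`_(s * 5) - v \in pdvd 5 1.
  by move=> <-; apply: (@coef_res5 1 1 1 3).
have D s v : (quartic 1 (- 2%:R) 2%:R (- 1) * quartic 1 (- 2%:R) 2%:R (- 1)
       * quartic 1 (- 1) (- 1) 1 * quartic 1 (- 1) (- 1) 1)`_(s * 5) = v ->
  (invpoly 5 5 1 * invpoly 5 5 1 * invpoly 5 5 2 * invpoly 5 5 2)`_(s * 5) - v \in pdvd 5 1.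
  by move=> <-; apply: (@coef_res5 1 1 2 2).
have c1 := C 1%N (- 4%:R) ltac:(tab_tac; ring).
have c2 := C 2%N (- 122%:R) ltac:(tab_tac; ring).
have c3 := C 3%N (- 4%:R) ltac:(tab_tac; ring).
have d1 := D 1%N (- 6%:R) ltac:(tab_tac; ring).
have d2 := D 2%N (- 38%:R) ltac:(tab_tac; ring).
have d3 := D 3%N (- 6%:R) ltac:(tab_tac; ring).
have P a b c d s : (invpoly 5 5 a * invpoly 5 5 b * invpoly 5 5 c * invpoly 5 5 d)`_(s * 5)
    \in pint 5.
  by apply: coef_pint; do 3?apply: rpredM; apply: invpoly_over.
have := P 1%N 1%N 1%N 3%N 1%N; have := P 1%N 1%N 1%N 3%N 2%N.
have := P 1%N 1%N 1%N 3%N 3%N; have := P 1%N 1%N 2%N 2%N 1%N.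
have := P 1%N 1%N 2%N 2%N 2%N; have := P 1%N 1%N 2%N 2%N 3%N.
move: c1 c2 c3 d1 d2 d3; clear C D P.
pose cc s := (invpoly 5 5 1 * invpoly 5 5 1 * invpoly 5 5 1 * invpoly 5 5 3)`_(s * 5).
pose dd s := (invpoly 5 5 1 * invpoly 5 5 1 * invpoly 5 5 2 * invpoly 5 5 2)`_(s * 5).
rewrite -![(_ * invpoly 5 5 3)`_(_ * 5)]/(cc _) -![(_ * invpoly 5 5 2)`_(_ * 5)]/(dd _).
move: (cc 1%N) (cc 2%N) (cc 3%N) (dd 1%N) (dd 2%N) (dd 3%N) => {cc dd}.
move=> x1 x2 x3 y1 y2 y3 X1 X2 X3 Y1 Y2 Y3 hy3 hy2 hy1 hx3 hx2 hx1.
have N5 m : 5%:R * m%:R \in pdvd 5 1.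
  by apply: (@pdvd_expl 5 isT 1 _ m%:R); rewrite ?rpred_nat ?expr1.
(* Modulo 5 the binomial weights reduce [second_order] to this combination for [n = 5] and to its
   double for [n = 10]; in each case [h] holds the remaining multiples of 5. The residues sum to
   [8 * (-130) + 6 * (-50) = -5 * 268]. *)
have Z : 8%:R * (x1 + x2 + x3) + 6%:R * (y1 + y2 + y3) \in pdvd 5 1.
  have h8 := pdvdMl (p := 5) isT (rpred_nat _ 8) (rpredD (rpredD X1 X2) X3).
  have h6 := pdvdMl (p := 5) isT (rpred_nat _ 6) (rpredD (rpredD Y1 Y2) Y3).
  by apply: pdvd_eq (rpredB (rpredD h8 h6) (N5 268%N)) _; ring.
case: hn => ->.
  have h : 4%:R * (15%:R * x1 + 5%:R * x2 + x3) + 6%:R * (4%:R * y1 + y2) \in pint 5.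
    by rpred_tac.
  apply: pdvd_eq (rpredD Z (@pdvdXp 5 isT 1 _ h)) _.
  rewrite (_ : 'C(8, 5) = 56%N) // (_ : 'C(7, 4) = 35%N) // (_ : 'C(7, 5) = 21%N) //.
  rewrite (_ : 'C(6, 4) = 15%N) // (_ : 'C(6, 5) = 6%N) // (_ : 'C(5, 4) = 5%N) //.
  by rewrite (_ : 'C(5, 5) = 1%N) // expr1; ring.
have h : 4%:R * (415%:R * x1 + 250%:R * x2 + 142%:R * x3)
   + 6%:R * (158%:R * y1 + 92%:R * y2 + 50%:R * y3) \in pint 5.
  by rpred_tac.
apply: pdvd_eq (rpredD (rpredD Z Z) (@pdvdXp 5 isT 1 _ h)) _.
rewrite (_ : 'C(13, 5) = 1287%N) // (_ : 'C(12, 4) = 495%N) // (_ : 'C(12, 5) = 792%N) //.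
rewrite (_ : 'C(11, 4) = 330%N) // (_ : 'C(11, 5) = 462%N) // (_ : 'C(10, 4) = 210%N) //.
by rewrite (_ : 'C(10, 5) = 252%N) // expr1; ring.
Qed.

(** * Conclusion *)

Section Induction.
Variable p : nat.
Hypothesis p_prime : prime p.
Hypothesis p_ge5 : (5 <= p)%N.
Let p_gt0 : (0 < p)%N := prime_gt0 p_prime.

(* [p / 5 * B_{p-5}] is [p]-integral also for [p = 5]. *)
Let kappa := p%:R / 5%:R * bernoulli (p - 5).

Lemma pint_kappa : kappa \in pint p.
Proof.
rewrite /kappa; have [-> | ne5] := eqVneq p 5%N.
  by rewrite subnn bernoulli0 mulr1 divff ?rpred1.
have p5 : (5 < p)%N by rewrite ltn_neqAle eq_sym ne5.
apply: rpredM; first apply: rpredM; rewrite ?rpred_nat //.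
  by apply: pint_natV; apply: coprime_ltp.
by apply: pint_bernoulli => //; lia.
Qed.

Lemma T4_base : T4 p p + 48%:R * kappa \in pdvd p 2 /\
  T4 p (2 * p) + 240%:R * kappa \in pdvd p 2.
Proof.
rewrite /kappa; have [-> | ne5] := eqVneq p 5%N; last first.
  by apply: T4_base_ge7 => //; rewrite ltn_neqAle eq_sym ne5.
rewrite subnn bernoulli0 mulr1 divff // !mulr1 T4_5; split; last exact: T4_10.
by apply: (@pdvd_expl 5 isT 2 _ 2%:R); rewrite ?rpred_nat //; ring.
Qed.

(** Both coefficients of [T4_step] contain the factor [n], hence a factor [p], so knowledge modulo
    [p^(r+1)] at level [r] lifts to [p^(r+2)] at the next level. *)
Lemma T4_step_pdvd r n (a b : rat) : (0 < r)%N -> n = p \/ n = (2 * p)%N ->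
  T4 p (p ^ r) + a \in pdvd p r.+1 -> T4 p (2 * p ^ r) + b \in pdvd p r.+1 ->
  T4 p (n * p ^ r) + (n%:R * (4%:R - n%:R ^+ 2) / 3%:R * a
     + n%:R * (n%:R ^+ 2 - 1) / 6%:R * b) \in pdvd p r.+2.
Proof.
move=> r0 hn ha hb.
have pn : (p %| n)%N by case: hn => ->; rewrite ?dvdnn // dvdn_mull.
have n5 : (5 <= n)%N by case: hn => ->; lia.
have so : (1 < r)%N \/ second_order p (p ^ r) n \in pdvd p 1.
  have [r1|r1] := ltnP 1 r; [by left | right].
  have -> : r = 1%N by lia.
  have [p5 | ne5] := eqVneq p 5%N.
    by rewrite p5; apply: second_order_5; case: hn => ->; rewrite p5; [left | right].
  by apply: second_order_ge7 => //; rewrite ltn_neqAle eq_sym ne5.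
have S := T4_step p_prime p_ge5 r0 pn n5 so.
have c3 : coprime 3 p by apply: coprime_ltp => //; lia.
have c2 : coprime 2 p by apply: coprime_ltp => //; lia.
have h3 : 3%:R^-1 \in pint p by apply: pint_natV.
have h6 : 6%:R^-1 \in pint p by apply: pint_natV; rewrite (_ : 6 = 2 * 3)%N // coprimeMl c2.
have hn1 := pdvd1_nat p_gt0 pn.
have k1 : (4%:R - n%:R ^+ 2) * 3%:R^-1 \in pint p by rpred_tac.
have k2 : (n%:R ^+ 2 - 1) * 6%:R^-1 \in pint p by rpred_tac; apply: rpred1.
have A1 := pdvdM p_gt0 (pdvdMr p_gt0 hn1 k1) ha.
have A2 := pdvdM p_gt0 (pdvdMr p_gt0 hn1 k2) hb.
by apply: pdvd_eq (rpredD S (rpredD A1 A2)) _; ring.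
Qed.

(** One step maps the pair [(48, 240)] of the case [r = 1] to [p (24, 48)] up to the multiples
    [24 p^3] and [192 p^3], removed through [hz]. After that [(24, 48)] is mapped exactly to
    [p (24, 48)], which is why [r = 1] stands apart. *)
Lemma T4_prime_power r : (1 < r)%N ->
  T4 p (p ^ r) + 24%:R * (p%:R ^+ r.-1 * kappa) \in pdvd p r.+1 /\
  T4 p (2 * p ^ r) + 48%:R * (p%:R ^+ r.-1 * kappa) \in pdvd p r.+1.
Proof.
have hk := pint_kappa.
case: r => [//|]; elim=> [//|[|r] IH] _ /=.
  have [B1 B2] := T4_base.
  have {}B1 : T4 p (p ^ 1) + 48%:R * kappa \in pdvd p 2 by rewrite expn1.
  have {}B2 : T4 p (2 * p ^ 1) + 240%:R * kappa \in pdvd p 2 by rewrite expn1.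
  have S1 := T4_step_pdvd (r := 1) isT (or_introl erefl) B1 B2.
  have S2 := T4_step_pdvd (r := 1) isT (or_intror erefl) B1 B2.
  split.
    have hz : 24%:R * kappa \in pint p by rpred_tac.
    rewrite expnS; apply: pdvd_eq (rpredB S1 (pdvdXp p_gt0 3 hz)) _.
    by field.
  have hz : 192%:R * kappa \in pint p by rpred_tac.
  rewrite expnS mulnA; apply: pdvd_eq (rpredB S2 (pdvdXp p_gt0 3 hz)) _.
  by rewrite natrM; field.
have [//|H1 H2] := IH; rewrite /= in H1 H2.
have S1 := T4_step_pdvd (r := r.+2) isT (or_introl erefl) H1 H2.
have S2 := T4_step_pdvd (r := r.+2) isT (or_intror erefl) H1 H2.
split; first by rewrite expnS; apply: pdvd_eq S1 _; rewrite [p%:R ^+ r.+2]exprS; field.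
rewrite expnS mulnA; apply: pdvd_eq S2 _.
by rewrite natrM [p%:R ^+ r.+2]exprS; field.
Qed.

End Induction.

Theorem theorem3 (p r : nat) (p_prime : prime p) (p_ge5 : (5 <= p)%N)
    (r_gt0 : (0 < r)%N) :
  let S :=
    4%:R * sum4 p (2 * p ^ r)%N (fun i1 i2 i3 i4 =>
      (-1) ^+ i1 / (i1%:R * i2%:R * i3%:R * i4%:R))
    + 3%:R * sum4 p (2 * p ^ r)%N (fun i1 i2 i3 i4 =>
      (-1) ^+ (i1 + i2)%N / (i1%:R * i2%:R * i3%:R * i4%:R)) in
  (r = 1%N ->
     eqmod_rat p 2 S (216%:R / 5%:R * p%:R * bernoulli (p - 5)))
  /\
  ((1 < r)%N ->
     eqmod_rat p r.+1 S (36%:R / 5%:R * p%:R ^+ r * bernoulli (p - 5))).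
Proof.
have p_gt0 := prime_gt0 p_prime; have p_gt2 : (2 < p)%N by apply: leq_trans p_ge5.
rewrite alternating_sum4E //=.
have h2 : 2%:R^-1 \in pint p by apply: pint_natV; apply: coprime_ltp.
split=> [r1|r_gt1]; apply: eqmod_ratP.
  (* [-48/2 + 240 = 216]. *)
  have [B1 B2] := T4_base p_prime p_ge5; rewrite r1 expn1.
  by apply: pdvd_eq (rpredB (pdvdMl p_gt0 h2 B1) B2) _; field.
(* [-24/2 + 48 = 36]. *)
have [H1 H2] := T4_prime_power p_prime p_ge5 r_gt1.
apply: pdvd_eq (rpredB (pdvdMl p_gt0 h2 H1) H2) _.
by rewrite -[in 36%:R / _ * _](prednK r_gt0) [_ ^+ r.-1.+1]exprS; field.
Qed.
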